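(* Let $(\mathcal{V},\mathcal{H})$ be a complete interaction of $\Gamma^+$ on a unital C$^*$-algebra $\mathcal{A}$ such that at least one of the following holds: (a) each $\mathcal{V}_x$, $x\in\Gamma^+$, is a $*$-endomorphism (i.e. $(\mathcal{A},\Gamma^+,\mathcal{V})$ is a C$^*$-dynamical system); (b) $\mathcal{H}_x(1)\in Z(\mathcal{A})$ for all $x\in\Gamma^+$; (a') each $\mathcal{H}_x$ is a $*$-endomorphism; (b') $\mathcal{V}_x(1)\in Z(\mathcal{A})$ for all $x\in\Gamma^+$. Then both $\mathcal{V}$ and $\mathcal{H}$ are finely representable actions.
   Context: $Z(\mathcal{A})$ denotes the center of $\mathcal{A}$. $\Gamma$ is a totally ordered abelian group with identity $0$ and $\Gamma^+=\{x\in\Gamma:0\le x\}$. An action of $\Gamma^+$ on $\mathcal{A}$ is a map $x\mapsto\mathcal{V}_x$ from $\Gamma^+$ into the bounded positive linear maps $\mathcal{A}\to\mathcal{A}$ with $\mathcal{V}_0=\mathrm{Id}$ and $\mathcal{V}_x\circ\mathcal{V}_y=\mathcal{V}_{x+y}$. An interaction is a pair $(\mathcal{V},\mathcal{H})$ of actions such that for every $x\in\Gamma^+$: (i) $\mathcal{V}_x\mathcal{H}_x\mathcal{V}_x=\mathcal{V}_x$; (ii) $\mathcal{H}_x\mathcal{V}_x\mathcal{H}_x=\mathcal{H}_x$; (iii) $\mathcal{V}_x(ab)=\mathcal{V}_x(a)\mathcal{V}_x(b)$ whenever $a$ or $b$ belongs to $\mathcal{H}_x(\mathcal{A})$; (iv)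 $\mathcal{H}_x(ab)=\mathcal{H}_x(a)\mathcal{H}_x(b)$ whenever $a$ or $b$ belongs to $\mathcal{V}_x(\mathcal{A})$. It is complete if moreover $\mathcal{H}_x(\mathcal{V}_x(a))=\mathcal{H}_x(1)a\mathcal{H}_x(1)$ and $\mathcal{V}_x(\mathcal{H}_x(a))=\mathcal{V}_x(1)a\mathcal{V}_x(1)$ for all $x,a$, and $\mathcal{H}_y(1)\mathcal{V}_x(1)=\mathcal{V}_x(1)\mathcal{H}_y(1)$ for all $x,y\in\Gamma^+$. A covariant representation of an action $\mathcal{V}$ is a triple $(C,\sigma,U)$ with $C$ a unital C$^*$-algebra, $\sigma:\mathcal{A}\to C$ a unital injective $*$-homomorphism, and $U:\Gamma^+\to C$ a semigroup homomorphism with each $U_x$ a partial isometry, such that $\sigma(\mathcal{V}_x(a))=U_x\sigma(a)U_x^*$ and $U_x^*\sigma(a)U_x\in\sigma(\mathcal{A})$ for all $a\in\mathcal{A}$, $x\in\Gamma^+$; $\mathcal{V}$ is finely representable if it admits a covariant representation. *)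

(* Defs.v *)
From HB Require Import structures.
From mathcomp Require Import all_boot all_order all_algebra.
From mathcomp Require Import reals complex.
Set Implicit Arguments. Unset Strict Implicit. Unset Printing Implicit Defensive.
Import Order.TTheory GRing.Theory Num.Theory.
Local Open Scope ring_scope.

Definition cmod (R : realType) (k : R[i]) : R :=
  Num.sqrt (complex.Re k ^+ 2 + complex.Im k ^+ 2).

Definition cauchy_seq (R : realType) (A : zmodType) (nrm : A -> R)
    (u : nat -> A) : Prop :=
  forall e : R, 0 < e -> exists N : nat, forall m n : nat,
      (N <= m)%N -> (N <= n)%N -> nrm (u m - u n) < e.

Definition converges_to (R : realType) (A : zmodType) (nrm : A -> R)
    (u : nat -> A) (l : A) : Prop :=
  forall e : R, 0 < e -> exists N : nat, forall n : nat,
      (N <= n)%N -> nrm (u n - l) < e.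

Record is_unital_cstar (R : realType) (A : algType R[i])
    (star : A -> A) (nrm : A -> R) : Prop := IsUnitalCStar {
  star_add : forall a b, star (a + b) = star a + star b;
  star_scale : forall (k : R[i]) a, star (k *: a) = (conjc k) *: star a;
  star_mul : forall a b, star (a * b) = star b * star a;
  star_invol : forall a, star (star a) = a;
  nrm_ge0 : forall a, 0 <= nrm a;
  nrm_eq0 : forall a, nrm a = 0 -> a = 0;
  nrm_add : forall a b, nrm (a + b) <= nrm a + nrm b;
  nrm_scale : forall (k : R[i]) a, nrm (k *: a) = cmod k * nrm a;
  nrm_mul : forall a b, nrm (a * b) <= nrm a * nrm b;
  nrm_cstar : forall a, nrm (star a * a) = nrm a ^+ 2;
  nrm_complete : forall u : nat -> A, cauchy_seq nrm u ->
      exists l, converges_to nrm u l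
}.

Record cstar_alg (R : realType) := CStarAlg {
  cs_car :> algType R[i];
  cs_star : cs_car -> cs_car;
  cs_nrm : cs_car -> R;
  cs_ax : is_unital_cstar cs_star cs_nrm
}.

Arguments cs_star {R} c _.
Arguments cs_nrm {R} c _.

Section CStarNotions.
Variable R : realType.

Definition positive_elt (A : cstar_alg R) (a : A) : Prop :=
  exists b : A, a = cs_star A b * b.

Definition in_center (A : cstar_alg R) (z : A) : Prop :=
  forall a : A, z * a = a * z.

Definition lin_map (A B : cstar_alg R) (T : A -> B) : Prop :=
  forall (k : R[i]) (a b : A), T (k *: a + b) = k *: T a + T b.

Definition bounded_map (A B : cstar_alg R) (T : A -> B) : Prop :=
  exists M : R, forall a : A, cs_nrm B (T a) <= M * cs_nrm A a.

Definition positive_map (A B : cstar_alg R) (T : A -> B) : Prop :=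
  forall a : A, positive_elt a -> positive_elt (T a).

Definition bpl_map (A B : cstar_alg R) (T : A -> B) : Prop :=
  [/\ lin_map T, bounded_map T & positive_map T].

Definition star_hom (A B : cstar_alg R) (T : A -> B) : Prop :=
  [/\ lin_map T,
      (forall a b : A, T (a * b) = T a * T b) &
      (forall a : A, T (cs_star A a) = cs_star B (T a))].

Definition partial_isometry (C : cstar_alg R) (u : C) : Prop :=
  u * cs_star C u * u = u.
End CStarNotions.

Definition tot_ordered_group (G : zmodType) (le : rel G) : Prop :=
  [/\ (forall x, le x x),
      (forall x y, le x y -> le y x -> x = y),
      (forall x y z, le x y -> le y z -> le x z),
      (forall x y, le x y \/ le y x) &
      (forall x y z, le x y -> le (x + z) (y + z))].

Section Actions.
Variables (R : realType) (G : zmodType) (le : rel G) (A : cstar_alg R).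

(* an action of Gamma^+ on A; V is only relevant on Gamma^+ *)
Definition is_action (V : G -> A -> A) : Prop :=
  [/\ (forall x, le 0 x -> bpl_map (V x)),
      V 0 = id &
      (forall x y, le 0 x -> le 0 y -> V x \o V y = V (x + y))].

Definition in_range (T : A -> A) (b : A) : Prop := exists c, b = T c.

Definition is_interaction (V H : G -> A -> A) : Prop :=
  [/\ is_action V, is_action H &
   forall x, le 0 x ->
   [/\ V x \o H x \o V x = V x,
       H x \o V x \o H x = H x,
       (forall a b, in_range (H x) a \/ in_range (H x) b ->
                    V x (a * b) = V x a * V x b) &
       (forall a b, in_range (V x) a \/ in_range (V x) b ->
                    H x (a * b) = H x a * H x b)]].

Definition is_complete_interaction (V H : G -> A -> A) : Prop :=
  [/\ is_interaction V H,
      (forall x a, le 0 x -> H x (V x a) = H x 1 * a * H x 1),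
      (forall x a, le 0 x -> V x (H x a) = V x 1 * a * V x 1) &
      (forall x y, le 0 x -> le 0 y -> H y 1 * V x 1 = V x 1 * H y 1)].

Definition covariant_rep (V : G -> A -> A) (C : cstar_alg R)
    (sigma : A -> C) (U : G -> C) : Prop :=
  [/\ [/\ star_hom sigma, sigma 1 = 1 & injective sigma],
      (forall x y, le 0 x -> le 0 y -> U (x + y) = U x * U y),
      (forall x, le 0 x -> partial_isometry (U x)) &
      (forall x a, le 0 x ->
         sigma (V x a) = U x * sigma a * cs_star C (U x) /\
         exists b : A, cs_star C (U x) * sigma a * U x = sigma b)].

Definition finely_representable (V : G -> A -> A) : Prop :=
  exists (C : cstar_alg R) (sigma : A -> C) (U : G -> C),
    covariant_rep V sigma U.
End Actions.

(* Main.v *)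
(* If every V_x is multiplicative then H_x(1) is central, and conditions (a'), (b')
   become (a), (b) after exchanging V and H, so assume that every H_x(1) is
   central.  Write f_x = V_x(1).  Then V_x is an endomorphism which restricts to
   an isomorphism of H_x(1) A onto f_x A f_x with inverse H_x, and both actions
   are implemented on a Hilbert A-module: the l2-sum over g in Gamma of the spaces
   B_g = f_n A f_p, where p and n are the positive and negative parts of g and
   a in B_g stands for U_n^* a U_p.  The inner product on B_g is H_p(a^* b), the
   algebra acts on B_g through V_n, and U_y maps a in B_g to V_k(a) in B_(g+y),
   where k = (g+y)^+ - g^+.  The C*-algebra is that of all bounded adjointable
   operators on this module.  Its C*-identity needs the Cauchy-Schwarz inequality,
   hence the order structure of a C*-algebra, which is obtained from square roots
   (the iteration y -> (x + y^2) / 2) and the Kelley-Vaught theorem. *)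
Require Import Defs.
From HB Require Import structures.
From mathcomp Require Import all_boot all_order all_algebra.
From mathcomp Require Import finmap boolp classical_sets reals complex.
From mathcomp Require Import ring lra.
Import Order.TTheory GRing.Theory Num.Theory.
Local Open Scope ring_scope.
Set Implicit Arguments. Unset Strict Implicit. Unset Printing Implicit Defensive.

(** The formulas on the module are forced. In an algebra carrying the required [U], with
    [U_p^† a U_p = H_p(a)], one has [U_p^† U_p = H_p(1)], and centrality gives [U_p c = V_p(c) U_p].
    Hence [U_n^† a U_p] and [U_n^† b U_p] have inner product [U_p^† a^† f_n b U_p = H_p(a^† b)],
    left multiplication by [c] replaces [a] by [V_n(c) a], and right multiplication by [c] replaces
    it by [a V_p(c)]. As the order is total, in a product [U_y U_n^†] the smaller index cancels, so
    words with [n = 0] or [p = 0] are stable under [U_y]; this yields the increment [k].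

    Inner products with values in A spare any choice of states. In degree 0 the fibre is A acted on
    by left multiplication, which makes the representation injective. The same pair satisfies
    [U_x^† sigma(a) U_x = sigma(H_x(a))], so that [U^†] serves the other action. *)

Section ComplexModulus.
Variable R : realType.

Lemma cmodE (k : R[i]) : cmod k = Normc.normc k.
Proof. by case: k. Qed.

Lemma cmod_ge0 (k : R[i]) : 0 <= cmod k.
Proof. exact: sqrtr_ge0. Qed.

Lemma cmod_real (r : R) : cmod (r%:C)%C = `|r|.
Proof. by rewrite /cmod /= expr0n addr0 sqrtr_sqr. Qed.

Lemma conjc_i : conjc ('i : R[i])%C = - ('i)%C.
Proof. by apply/eqP; rewrite eq_complex /= oppr0 !eqxx. Qed.

Lemma cmod_eq0 (k : R[i]) : cmod k = 0 -> k = 0.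
Proof. by rewrite cmodE; apply: Normc.eq0_normc. Qed.

Lemma conjcM_cmod (k : R[i]) : conjc k * k = ((cmod k ^+ 2)%:C)%C.
Proof.
case: k => a b; rewrite /cmod sqr_sqrtr ?addr_ge0 ?sqr_ge0 //.
by apply/eqP; rewrite eq_complex /=; apply/andP; split; apply/eqP; ring.
Qed.

End ComplexModulus.

Notation "r *r: a" := ((r%:C)%C *: a) (at level 40).

Section RealScaling.
Variables (R : realType) (E : lmodType R[i]).
Implicit Types (r s : R) (a b : E).

Lemma rscaleDl r s a : (r + s) *r: a = r *r: a + s *r: a.
Proof. by rewrite rmorphD scalerDl. Qed.

Lemma rscaleA r s a : r *r: (s *r: a) = (r * s) *r: a.
Proof. by rewrite scalerA -rmorphM. Qed.

Lemma rscale1 a : 1 *r: a = a.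
Proof. by rewrite rmorph1 scale1r. Qed.

Lemma rscale0 a : 0 *r: a = 0.
Proof. by rewrite rmorph0 scale0r. Qed.

Lemma rscaleNat n a : n%:R *r: a = a *+ n.
Proof. by rewrite rmorph_nat scaler_nat. Qed.

Lemma rscale_half a : 2^-1 *r: (a + a) = a.
Proof. by rewrite -mulr2n -rscaleNat rscaleA mulVf ?pnatr_eq0 // rscale1. Qed.

End RealScaling.

(** * Elementary identities in a C*-algebra *)

Section CStarBasics.
Variables (R : realType) (A : cstar_alg R).
Local Notation "a ^†" := (cs_star A a) (at level 2, format "a ^†").
Local Notation nrm := (cs_nrm A).
Implicit Types (a b c x y : A) (r s t : R).

Lemma starD a b : (a + b)^† = a^† + b^†.
Proof. exact: (star_add (cs_ax A)). Qed.

Lemma starZ (k : R[i]) a : (k *: a)^† = conjc k *: a^†.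
Proof. exact: (star_scale (cs_ax A)). Qed.

Lemma starZr r a : (r *r: a)^† = r *r: a^†.
Proof. by rewrite starZ conjc_real. Qed.

Lemma starM a b : (a * b)^† = b^† * a^†.
Proof. exact: (star_mul (cs_ax A)). Qed.

Lemma starK a : a^†^† = a.
Proof. exact: (star_invol (cs_ax A)). Qed.

Lemma starN a : (- a)^† = - a^†.
Proof. by rewrite -scaleN1r starZ rmorphN1 scaleN1r. Qed.

Lemma starB a b : (a - b)^† = a^† - b^†.
Proof. by rewrite starD starN. Qed.

Lemma star0 : (0 : A)^† = 0.
Proof. by have := starZ 0 0; rewrite scaler0 conjc0 scale0r. Qed.

Lemma star1 : (1 : A)^† = 1.
Proof. by have := starM 1^† 1; rewrite mulr1 !starK mulr1. Qed.

Lemma norm_ge0 a : 0 <= nrm a.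
Proof. exact: (nrm_ge0 (cs_ax A)). Qed.

Lemma norm_eq0 a : nrm a = 0 -> a = 0.
Proof. exact: (nrm_eq0 (cs_ax A)). Qed.

Lemma normD a b : nrm (a + b) <= nrm a + nrm b.
Proof. exact: (nrm_add (cs_ax A)). Qed.

Lemma normZ (k : R[i]) a : nrm (k *: a) = cmod k * nrm a.
Proof. exact: (nrm_scale (cs_ax A)). Qed.

Lemma normZr r a : nrm (r *r: a) = `|r| * nrm a.
Proof. by rewrite normZ cmod_real. Qed.

Lemma normM a b : nrm (a * b) <= nrm a * nrm b.
Proof. exact: (nrm_mul (cs_ax A)). Qed.

Lemma norm_star_mul a : nrm (a^† * a) = nrm a ^+ 2.
Proof. exact: (nrm_cstar (cs_ax A)). Qed.

Lemma norm0 : nrm 0 = 0.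
Proof. by have := normZr 0 0; rewrite rscale0 normr0 mul0r. Qed.

Lemma normN a : nrm (- a) = nrm a.
Proof.
by rewrite -scaleN1r normZ cmodE -[X in X * _]/(Normc.normc (- (1 : Rcomplex R)))
  normcN Normc.normc1 mul1r.
Qed.

Lemma norm_distC a b : nrm (a - b) = nrm (b - a).
Proof. by rewrite -normN opprB. Qed.

Lemma norm_dist_trans c a b : nrm (a - b) <= nrm (a - c) + nrm (c - b).
Proof. by rewrite -[a - b](subrKA c) normD. Qed.

Lemma norm_star a : nrm a^† = nrm a.
Proof.
have le_norm_star b : nrm b <= nrm b^†.
  have [b0|b0] := eqVneq (nrm b) 0; first by rewrite b0 norm_ge0.
  have bp : 0 < nrm b by rewrite lt_def b0 norm_ge0.
  by rewrite -(ler_pM2r bp) -expr2 -norm_star_mul normM.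
by apply/eqP; rewrite eq_le le_norm_star andbT -{2}[a]starK le_norm_star.
Qed.

Lemma norm_sqr a : a^† = a -> nrm (a * a) = nrm a ^+ 2.
Proof. by move=> sa; rewrite -norm_star_mul sa. Qed.

Lemma norm1 : nrm 1 = 1.
Proof.
have := norm_sqr star1; rewrite mulr1 expr2 => h.
have n0 : nrm 1 != 0.
  by apply/eqP => /norm_eq0 /eqP; rewrite (negbTE (oner_neq0 A)).
by apply: (mulfI n0); rewrite -h mulr1.
Qed.

Lemma norm_rscalar r : 0 <= r -> nrm (r *r: (1 : A)) = r.
Proof. by move=> r0; rewrite normZr norm1 mulr1 ger0_norm. Qed.

Lemma eq_of_norm_small a b : (forall e, 0 < e -> nrm (a - b) <= e) -> a = b.
Proof.
move=> h; apply/eqP; rewrite -subr_eq0; apply/eqP/norm_eq0/eqP.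
rewrite eq_le norm_ge0 andbT; apply/ler_addgt0Pr => e e0.
by rewrite add0r h.
Qed.

(** A double-commutant condition in place of membership in the algebra generated by [a]: it makes
    square roots of commuting elements commute without a functional calculus. *)
Definition comm_with_commutant a b := forall z, z * a = a * z -> z * b = b * z.

Lemma star_mul_eq0 a : a^† * a = 0 -> a = 0.
Proof.
move=> h; apply: norm_eq0; apply/eqP.
by rewrite -sqrf_eq0 -norm_star_mul h norm0.
Qed.

End CStarBasics.

(** * Norm convergence of sequences *)

Section Limits.
Variables (R : realType) (A : cstar_alg R).
Local Notation "a ^†" := (cs_star A a) (at level 2, format "a ^†").
Local Notation nrm := (cs_nrm A).
Local Notation cvg := (converges_to nrm).
Implicit Types (u v : nat -> A) (a b l m : A).

Lemma cvg_uniq u l m : cvg u l -> cvg u m -> l = m.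
Proof.
move=> hl hm; apply: eq_of_norm_small => e e0.
have e2 : 0 < e / 2 by rewrite divr_gt0.
have [N1 h1] := hl _ e2; have [N2 h2] := hm _ e2.
have := h1 _ (leq_maxl N1 N2); have := h2 _ (leq_maxr N1 N2).
have := norm_dist_trans (u (maxn N1 N2)) l m.
rewrite (norm_distC l (u _)); lra.
Qed.

Lemma cvg_cst a : cvg (fun=> a) a.
Proof. by move=> e e0; exists 0%N => n _; rewrite subrr norm0. Qed.

Lemma cvgD u v l m : cvg u l -> cvg v m -> cvg (fun n => u n + v n) (l + m).
Proof.
move=> hl hm e e0.
have e2 : 0 < e / 2 by rewrite divr_gt0.
have [N1 h1] := hl _ e2; have [N2 h2] := hm _ e2.
exists (maxn N1 N2) => n; rewrite geq_max => /andP[n1 n2].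
have := h1 _ n1; have := h2 _ n2; have := normD (u n - l) (v n - m).
rewrite addrACA -opprD; lra.
Qed.

Lemma cvg_sum (I : Type) (F : seq I) (f : I -> nat -> A) (g : I -> A) :
  (forall i, cvg (f i) (g i)) ->
  cvg (fun n => \sum_(i <- F) f i n) (\sum_(i <- F) g i).
Proof.
move=> h; elim: F => [|i F IH].
  rewrite big_nil (_ : (fun _ => _) = fun=> 0) ?funeqE; first exact: cvg_cst.
  by move=> n; rewrite big_nil.
rewrite big_cons (_ : (fun _ => _) = fun n => f i n + \sum_(j <- F) f j n) ?funeqE.
  exact: cvgD.
by move=> n; rewrite big_cons.
Qed.

Lemma cvg_dominated (M : R) (f : nat -> A) l u m :
  cvg u m -> (forall n, nrm (f n - l) <= M * nrm (u n - m)) -> cvg f l.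
Proof.
move=> hu hf e e0.
have M1 : 0 < `|M| + 1 by rewrite ltr_wpDl.
have [N h] := hu (e / (`|M| + 1)) (divr_gt0 e0 M1).
exists N => n /h; rewrite ltr_pdivlMr // => lt_e.
apply: le_lt_trans lt_e; rewrite mulrC; apply: le_trans (hf n) _.
by apply: ler_wpM2r; [exact: norm_ge0|rewrite (le_trans (ler_norm M)) ?lerDl].
Qed.

Lemma cvg_star u l : cvg u l -> cvg (fun n => (u n)^†) l^†.
Proof.
by move=> h; apply: (cvg_dominated (M := 1) h) => n; rewrite mul1r -starB norm_star.
Qed.

Lemma cvg_mull a u l : cvg u l -> cvg (fun n => a * u n) (a * l).
Proof.
by move=> h; apply: (cvg_dominated (M := nrm a) h) => n; rewrite -mulrBr normM.
Qed.

Lemma cvg_mulr a u l : cvg u l -> cvg (fun n => u n * a) (l * a).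
Proof.
move=> h; apply: (cvg_dominated (M := nrm a) h) => n.
by rewrite -mulrBl mulrC normM.
Qed.

Lemma cvgN u l : cvg u l -> cvg (fun n => - u n) (- l).
Proof.
by move=> h; apply: (cvg_dominated (M := 1) h) => n; rewrite -opprD normN mul1r.
Qed.

Lemma cvg_shift u l : cvg u l -> cvg (fun n => u n.+1) l.
Proof.
move=> h e e0; have [N hN] := h _ e0; exists N => n Nn; apply: hN.
exact: leq_trans Nn (leqnSn n).
Qed.

Lemma cvg_norm_le (M : R) u l (N : nat) :
  cvg u l -> (forall n, (N <= n)%N -> nrm (u n) <= M) -> nrm l <= M.
Proof.
move=> hu hM; apply/ler_addgt0Pr => e e0.
have [N1 h] := hu _ e0.
have := h _ (leq_maxl N1 N); have := hM _ (leq_maxr N1 N).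
have := norm_dist_trans (u (maxn N1 N)) l 0.
rewrite !subr0 (norm_distC l (u _)); lra.
Qed.

Lemma cauchy_seq_cvg u : cauchy_seq nrm u -> exists l, cvg u l.
Proof. exact: (nrm_complete (cs_ax A)). Qed.

End Limits.

(** * Square roots by an iteration with a scalar majorant *)

Section SquareRoot.
Local Open Scope classical_set_scope.
Variables (R : realType) (A : cstar_alg R).
Local Notation "a ^†" := (cs_star A a) (at level 2, format "a ^†").
Local Notation nrm := (cs_nrm A).
Local Notation cvg := (converges_to nrm).

(** The fixed-point equation [2 y = x + y^2] says [(1 - y)^2 = 1 - x]: the limit is
    [1 - sqrt (1 - x)]. *)
Fixpoint sqrt_iter (x : A) n : A :=
  if n is m.+1 then 2^-1 *r: (x + sqrt_iter x m * sqrt_iter x m) else 0.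

(** The iteration for the scalar [x = 1]; it majorises the norms of the iterates and of their
    increments. *)
Fixpoint sqrt_bound n : R :=
  if n is m.+1 then (1 + sqrt_bound m ^+ 2) / 2 else 0.

Lemma sqrt_bound_itv n : 0 <= sqrt_bound n <= 1.
Proof.
elim: n => [|n /andP[h0 h1]]; first by rewrite lexx ler01.
by rewrite [sqrt_bound n.+1]/=; apply/andP; split; nra.
Qed.

(** Monotone bounded convergence, without a rate: [r -> (1 + r^2) / 2] has slope 1 at its fixed
    point 1, so no geometric estimate is available. *)
Lemma sqrt_bound_cauchy (e : R) : 0 < e ->
  exists N, forall m n, (N <= m)%N -> (m <= n)%N ->
    sqrt_bound n - sqrt_bound m < e.
Proof.
move=> e0; pose S := range sqrt_bound.
have nd m n : (m <= n)%N -> sqrt_bound m <= sqrt_bound n.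
  apply: (homo_leq (@lexx _ _) (@le_trans _ _)) => k.
  by rewrite /= ; have /andP[] := sqrt_bound_itv k; nra.
have hS : has_sup S.
  split; first by exists 0; exists 0%N.
  by exists 1 => _ [n _ <-]; have /andP[] := sqrt_bound_itv n.
have [_ [N _ <-] hN] := sup_adherent e0 hS.
exists N => m n Nm mn.
have := nd _ _ Nm; have : sqrt_bound n <= sup S by apply: ub_le_sup hS.2 _ _; exists n.
lra.
Qed.

Section Iteration.
Variable x : A.
Hypothesis x1 : nrm x <= 1.

Lemma sqrt_iter_norm n : nrm (sqrt_iter x n) <= sqrt_bound n.
Proof.
elim: n => [|n IH] /=; first by rewrite norm0.
rewrite normZr ger0_norm ?invr_ge0 // mulrC ler_pM2r ?invr_gt0 //.
rewrite (le_trans (normD _ _)) // lerD // (le_trans (normM _ _)) //.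
by rewrite expr2 ler_pM ?norm_ge0.
Qed.

(** The identity [u^2 - v^2 = u (u - v) + (u - v) v] needs no commutation and holds for the majorant
    as well, so the two increments are compared term by term. *)
Lemma sqrt_iter_step n :
  nrm (sqrt_iter x n.+1 - sqrt_iter x n) <= sqrt_bound n.+1 - sqrt_bound n.
Proof.
elim: n => [|n IH].
  by have := sqrt_iter_norm 1; rewrite [sqrt_iter x 0]/= [sqrt_bound 0]/= !subr0.
set u := sqrt_iter x n.+1 in IH *; set v := sqrt_iter x n in IH *.
have -> : sqrt_iter x n.+2 - u = 2^-1 *r: (u * (u - v) + (u - v) * v).
  rewrite [sqrt_iter x n.+2]/= -/u {3}/u /= -/v -scalerBr; congr (_ *: _).
  by rewrite opprD addrACA subrr add0r mulrBr mulrBl addrA subrK.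
rewrite normZr ger0_norm ?invr_ge0 //.
have nu := sqrt_iter_norm n.+1; have nv := sqrt_iter_norm n.
have h := normD (u * (u - v)) ((u - v) * v).
have h1 : nrm (u * (u - v)) <= sqrt_bound n.+1 * (sqrt_bound n.+1 - sqrt_bound n).
  by rewrite (le_trans (normM _ _)) // ler_pM ?norm_ge0.
have h2 : nrm ((u - v) * v) <= (sqrt_bound n.+1 - sqrt_bound n) * sqrt_bound n.
  by rewrite (le_trans (normM _ _)) // ler_pM ?norm_ge0.
rewrite [sqrt_bound n.+2]/= -/(sqrt_bound n.+1).
have -> : (1 + sqrt_bound n.+1 ^+ 2) / 2 - sqrt_bound n.+1 = 2^-1 *
    (sqrt_bound n.+1 * (sqrt_bound n.+1 - sqrt_bound n) +
    (sqrt_bound n.+1 - sqrt_bound n) * sqrt_bound n).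
  by rewrite [in X in _ - X]/=; field.
by rewrite ler_pM2l ?invr_gt0 //; lra.
Qed.

Lemma sqrt_iter_dist m n : (m <= n)%N ->
  nrm (sqrt_iter x n - sqrt_iter x m) <= sqrt_bound n - sqrt_bound m.
Proof.
move=> /subnK <-; elim: (n - m)%N => [|k IH].
  by rewrite add0n !subrr norm0.
have := norm_dist_trans (sqrt_iter x (k + m)) (sqrt_iter x (k.+1 + m)) (sqrt_iter x m).
have := sqrt_iter_step (k + m); rewrite -addSn; lra.
Qed.

Lemma sqrt_iter_cauchy : cauchy_seq nrm (sqrt_iter x).
Proof.
move=> e e0; have [N hN] := sqrt_bound_cauchy e0.
exists N => m n Nm Nn; case/orP: (leq_total m n) => mn.
  by rewrite norm_distC (le_lt_trans (sqrt_iter_dist mn)) ?hN.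
by rewrite (le_lt_trans (sqrt_iter_dist mn)) ?hN.
Qed.

Lemma sqrt_iter_limit : x^† = x -> exists y : A,
  [/\ y^† = y, nrm y <= 1, y + y = x + y * y & comm_with_commutant x y].
Proof.
move=> sx; have [y hy] := cauchy_seq_cvg sqrt_iter_cauchy.
have u1 n : nrm (sqrt_iter x n) <= 1.
  by have /andP[_] := sqrt_bound_itv n; apply: le_trans (sqrt_iter_norm n).
have y1 : nrm y <= 1 by apply: (cvg_norm_le (N := 0) hy).
exists y; split => //.
- have su n : (sqrt_iter x n)^† = sqrt_iter x n.
    elim: n => [|n IH] /=; first exact: star0.
    by rewrite starZr starD starM IH sx.
  apply: (cvg_uniq _ hy); have := cvg_star hy.
  by rewrite (_ : (fun _ => _) = sqrt_iter x) // funeqE.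
- have h2 : cvg (fun n => sqrt_iter x n * sqrt_iter x n) (y * y).
    apply: (cvg_dominated (M := 2) hy) => n; set u := sqrt_iter x n.
    have -> : u * u - y * y = u * (u - y) + (u - y) * y.
      by rewrite mulrBr mulrBl addrA subrK.
    have := normD (u * (u - y)) ((u - y) * y).
    have := normM u (u - y); have := normM (u - y) y.
    by have := u1 n; rewrite -/u; have := norm_ge0 (u - y); nra.
  have h3 : cvg (fun n => sqrt_iter x n.+1 + sqrt_iter x n.+1) (x + y * y).
    have := cvgD (cvg_cst x) h2.
    rewrite (_ : (fun n => x + _) = fun n => sqrt_iter x n.+1 + sqrt_iter x n.+1) //.
    by apply/funext => n; rewrite /= -scalerDr rscale_half.
  exact: cvg_uniq (cvgD (cvg_shift hy) (cvg_shift hy)) h3.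
- move=> z zx.
  have zu n : z * sqrt_iter x n = sqrt_iter x n * z.
    elim: n => [|n IH] /=; first by rewrite mulr0 mul0r.
    by rewrite -scalerAr -scalerAl mulrDr mulrDl zx mulrA IH -!mulrA IH.
  apply: cvg_uniq (cvg_mull z hy) _; have := cvg_mulr z hy.
  by rewrite (_ : (fun n => _ * z) = fun n => z * sqrt_iter x n) // funeqE.
Qed.

End Iteration.
End SquareRoot.

(** * The cone of nonnegative elements *)

Section Positivity.
Variables (R : realType) (A : cstar_alg R).
Local Notation "a ^†" := (cs_star A a) (at level 2, format "a ^†").
Local Notation nrm := (cs_nrm A).
Implicit Types (a b c x y z h : A) (r s t : R).

(* For self-adjoint [a] the bound says that the spectrum lies in [0, 2t]. *)
Definition nonneg a := a^† = a /\ exists2 t, 0 <= t & nrm (t *r: 1 - a) <= t.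

Lemma nonneg_sa a : nonneg a -> a^† = a. Proof. by case. Qed.

Lemma nonnegD a b : nonneg a -> nonneg b -> nonneg (a + b).
Proof.
move=> [sa [s s0 hs]] [sb [t t0 ht]]; split; first by rewrite starD sa sb.
exists (s + t); rewrite ?addr_ge0 // rscaleDl opprD addrACA.
exact: le_trans (normD _ _) (lerD hs ht).
Qed.

Lemma nonnegZ r a : 0 <= r -> nonneg a -> nonneg (r *r: a).
Proof.
move=> r0 [sa [t t0 ht]]; split; first by rewrite starZr sa.
exists (r * t); rewrite ?mulr_ge0 // -rscaleA -scalerBr normZr ger0_norm //.
exact: ler_wpM2l.
Qed.

Lemma nonneg_rscalar r : 0 <= r -> nonneg (r *r: 1).
Proof.
by move=> r0; split; [rewrite starZr star1|exists r; rewrite // subrr norm0].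
Qed.

Lemma nonneg0 : nonneg 0.
Proof. by rewrite -(rscale0 (1 : A)); apply: nonneg_rscalar. Qed.

Lemma nonneg_sum (I : Type) (F : seq I) (f : I -> A) :
  (forall i, nonneg (f i)) -> nonneg (\sum_(i <- F) f i).
Proof. by move=> h; apply: big_ind => //; [exact: nonneg0|exact: nonnegD]. Qed.

Lemma nonneg_sub_sum (I : Type) (F : seq I) (f g : I -> A) :
  (forall i, nonneg (g i - f i)) ->
  nonneg (\sum_(i <- F) g i - \sum_(i <- F) f i).
Proof. by move=> h; rewrite -sumrB; apply: nonneg_sum. Qed.

Lemma nonneg_sub_trans b a c : nonneg (b - a) -> nonneg (c - b) -> nonneg (c - a).
Proof. by move=> h1 h2; rewrite -(subrKA b); apply: nonnegD. Qed.

Lemma nonneg_norm_sub a t : a^† = a -> nrm a <= t -> nonneg (t *r: 1 - a).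
Proof.
move=> sa at_; have t0 := le_trans (norm_ge0 a) at_.
split; first by rewrite starB starZr star1 sa.
by exists t; rewrite // opprB addrC subrK.
Qed.

(** For [t > 0] the element [x = 1 - a / t] has norm at most 1. The iteration gives [y] with
    [(1 - y)^2 = 1 - x], and [sqrt t (1 - y)] squares to [a]; its own nonnegativity is the bound
    [nrm y <= 1]. *)
Lemma nonneg_sqrt a : nonneg a ->
  exists h, [/\ h * h = a, nonneg h & comm_with_commutant a h].
Proof.
move=> [sa [t t0 ht]]; move: (t0); rewrite le_eqVlt => /orP[/eqP t0'|tp].
  have -> : a = 0.
    apply: norm_eq0; apply/eqP; rewrite eq_le norm_ge0 andbT.
    by move: ht; rewrite -t0' rscale0 sub0r normN.
  by exists 0; split; [rewrite mulr0|exact: nonneg0|move=> z _; rewrite mulr0 mul0r].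
pose x := t^-1 *r: (t *r: 1 - a).
have x1 : nrm x <= 1.
  by rewrite normZr ger0_norm ?invr_ge0 // mulrC ler_pdivrMr // mul1r.
have sx : x^† = x by rewrite starZr starB starZr star1 sa.
have [y [sy y1 ey cy]] := sqrt_iter_limit x1 sx.
have ax : a = t *r: (1 - x).
  rewrite scalerBr rscaleA mulfV ?gt_eqF // rscale1 opprB addrC subrK //.
pose q := Num.sqrt t; have qq : q * q = t by rewrite -expr2 sqr_sqrtr.
exists (q *r: (1 - y)); split.
- rewrite -scalerAl -scalerAr rscaleA qq ax; congr (_ *: _).
  rewrite mulrBl mul1r mulrBr mulr1 opprB -addrA; congr (_ + _).
  by rewrite addrA addrC addrA -[_ - y]opprD ey opprD subrK.
- split; first by rewrite starZr starB star1 sy.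
  exists q; first exact: sqrtr_ge0.
  rewrite scalerBr opprB addrC subrK normZr ger0_norm ?sqrtr_ge0 //.
  by rewrite ler_piMr ?sqrtr_ge0.
- move=> z za; have zx : z * x = x * z.
    rewrite /x -scalerAr -scalerAl mulrBr mulrBl za -scalerAr -scalerAl.
    by rewrite mulr1 mul1r.
  by rewrite -scalerAr -scalerAl mulrBr mulrBl (cy _ zx) mulr1 mul1r.
Qed.

(* [x^2 + y^2 = z^† z] for the normal element [z = x + i y], whose real part is [x]. *)
Lemma norm_sqr_le_sum_comm x y : x^† = x -> y^† = y -> x * y = y * x ->
  nrm (x * x) <= nrm (x * x + y * y).
Proof.
move=> sx sy xy; pose z := x + ('i)%C *: y.
have zs : z^† = x - ('i)%C *: y by rewrite starD starZ sx sy conjc_i scaleNr.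
have zz : z^† * z = x * x + y * y.
  have ii : ('i * 'i = -1 :> R[i])%C by rewrite -expr2 sqr_i.
  rewrite zs mulrDr !mulrBl -!scalerAr -!scalerAl xy scalerA ii.
  by rewrite scaleN1r opprK subrKA.
have h2 : 2 *r: x = z + z^†.
  by rewrite zs addrACA subrr addr0 rscaleNat mulr2n.
have : nrm (2 *r: x) <= 2 * nrm z.
  by rewrite h2 (le_trans (normD _ _)) // norm_star; lra.
rewrite normZr ger0_norm // ler_pM2l // => hxz.
by rewrite -zz norm_star_mul norm_sqr // lerXn2r // nnegrE norm_ge0.
Qed.

(** The square roots [h] of [a] and [k] of [t - a] commute, and [h^2 + k^2] is the scalar [t]. *)
Lemma norm_le_rscalar a t : 0 <= t -> nonneg a -> nonneg (t *r: 1 - a) -> nrm a <= t.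
Proof.
move=> t0 ha hb.
have [h [eh ph ch]] := nonneg_sqrt ha; have [k [ek pk ck]] := nonneg_sqrt hb.
have hk : h * k = k * h.
  apply: ck; rewrite mulrBr mulrBl -scalerAr -scalerAl mulr1 mul1r -eh.
  by rewrite mulrA.
have := norm_sqr_le_sum_comm (nonneg_sa ph) (nonneg_sa pk) hk.
by rewrite eh ek addrC subrK norm_rscalar.
Qed.

Lemma norm_mono a b : nonneg a -> nonneg (b - a) -> nrm a <= nrm b.
Proof.
move=> ha hb; apply: norm_le_rscalar => //; first exact: norm_ge0.
apply: (nonneg_sub_trans hb); apply: nonneg_norm_sub => //.
by have := nonneg_sa (nonnegD ha hb); rewrite addrC subrK.
Qed.

(** With [t = nrm (a * a)] and [k] a square root of [t - a^2] commuting with [a], the norm of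
    [t - a^2 = k^2] is at most that of [k^2 + a^2 = t]. *)
Lemma nonneg_sqr a : a^† = a -> nonneg (a * a).
Proof.
move=> sa; pose t := nrm (a * a).
have saa : (a * a)^† = a * a by rewrite starM sa.
have [k [ek pk ck]] := nonneg_sqrt (nonneg_norm_sub saa (lexx t)).
have ak : a * k = k * a.
  by apply: ck; rewrite mulrBr mulrBl -scalerAr -scalerAl mulr1 mul1r mulrA.
split=> //; exists t; first exact: norm_ge0.
have := norm_sqr_le_sum_comm (nonneg_sa pk) sa (esym ak).
by rewrite ek subrK norm_rscalar // norm_ge0.
Qed.

Lemma nonneg_closed (u : nat -> A) a :
  (forall n, nonneg (u n)) -> converges_to nrm u a -> nonneg a.
Proof.
move=> pu ua; split.
  apply: cvg_uniq (cvg_star ua) _.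
  by rewrite (_ : (fun n => _) = u) // funeqE => n; apply: nonneg_sa.
(* The radius in [nonneg (u n)] may vary with [n]; [nrm a + 1] bounds the norm of every late [u n]
   and so serves all of them. *)
have [N hN] := ua 1 ltr01; pose t := nrm a + 1.
have t0 : 0 <= t by rewrite addr_ge0 ?norm_ge0.
exists t => //.
apply: (cvg_norm_le (N := N) (u := fun n => t *r: 1 - u n)).
  exact: cvgD (cvg_cst _) (cvgN ua).
move=> n /hN hn; have un : nrm (u n) <= t.
  by have := norm_dist_trans a (u n) 0; rewrite !subr0 /t; lra.
apply: norm_le_rscalar => //; first exact: nonneg_norm_sub (nonneg_sa _) un.
by rewrite opprB addrC subrK.
Qed.

End Positivity.

(** * Nonnegativity of [x^† * x] *)

Section StarSquares.
Variables (R : realType) (A : cstar_alg R).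
Local Notation "a ^†" := (cs_star A a) (at level 2, format "a ^†").
Local Notation nrm := (cs_nrm A).
Implicit Types (a b c x y z h : A) (r s t : R).

(** [y y^† + y^† y] is half the sum of the squares of the self-adjoint elements [s = y + y^†] and
    [d = i (y - y^†)]. *)
Lemma nonneg_mul_star_of_neg y : nonneg (- (y^† * y)) -> nonneg (y * y^†).
Proof.
move=> hq; pose s := y + y^†; pose d := ('i)%C *: (y - y^†).
have ss : s^† = s by rewrite starD starK addrC.
have sd : d^† = d by rewrite starZ starB starK conjc_i scaleNr -scalerN opprB.
have ii : ('i * 'i = -1 :> R[i])%C by rewrite -expr2 sqr_i.
have dd : d * d = - ((y - y^†) * (y - y^†)).
  by rewrite -scalerAl -scalerAr scalerA ii scaleN1r.
have sdd : s * s + d * d = (y * y^† + y^† * y) + (y * y^† + y^† * y).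
  rewrite dd !mulrDl !mulrDr !mulrN !mulNr opprK !opprD !opprK.
  rewrite addrACA; rewrite [X in X + _ = _]addrACA subrr add0r.
  by rewrite [X in _ + X = _]addrACA subrr addr0 [RHS]addrACA.
have -> : y * y^† = 2^-1 *r: (s * s + d * d) + - (y^† * y).
  by rewrite sdd rscale_half addrK.
by apply: nonnegD hq; apply: nonnegZ; rewrite ?invr_ge0 //;
  apply: nonnegD; apply: nonneg_sqr.
Qed.

(* With [q = - y^† y] and [p = y y^† >= 0] one has [(1 - p) y = y (1 + q)], so
   [(1 + q) q (1 + q)], which dominates [2 q^2], has norm at most [1]. *)
Lemma norm1_star_mul_not_neg y : nrm y = 1 -> ~ nonneg (- (y^† * y)).
Proof.
move=> y1 hq; have hp := nonneg_mul_star_of_neg hq.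
set q := - (y^† * y) in hq *; set p := y * y^† in hp.
have sq := nonneg_sa hq; have nq : nrm q = 1.
  by rewrite normN norm_star_mul y1 expr1n.
have np : nrm p = 1 by rewrite -[p]/(y * y^†) -{1}(starK y) norm_star_mul norm_star y1 expr1n.
have n1p : nrm (1 - p) <= 1.
  have h := nonneg_norm_sub (nonneg_sa hp) (lexx (nrm p)).
  rewrite np rscale1 in h; apply: norm_le_rscalar => //.
  by rewrite rscale1 opprB addrC subrK.
have e1 : (1 - p) * y = y * (1 + q).
  by rewrite mulrBl mul1r mulrDr mulr1 mulrN /p mulrA.
have e2 : ((1 - p) * y)^† * ((1 - p) * y) = - ((1 + q) * q * (1 + q)).
  rewrite e1 starM starD star1 sq -mulrA [y^† * _]mulrA -[y^† * y]opprK -/q.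
  by rewrite mulNr mulrN mulrA.
have le1 : nrm ((1 + q) * q * (1 + q)) <= 1.
  rewrite -normN -e2 norm_star_mul expr_le1 ?norm_ge0 //.
  by rewrite (le_trans (normM _ _)) // y1 mulr1.
have e3 : (1 + q) * q * (1 + q) - (q * q + q * q) = q + q * q * q.
  rewrite mulrDl mul1r mulrDr mulr1 mulrDl.
  rewrite [_ + (q * q + _)]addrA -[q + q * q + q * q]addrA addrAC.
  by rewrite addrK.
have [g [eg pg _]] := nonneg_sqrt hq.
have hqqq : nonneg (q * q * q).
  have -> : q * q * q = (g * g * g) * (g * g * g) by rewrite -eg !mulrA.
  by apply: nonneg_sqr; rewrite !starM (nonneg_sa pg) mulrA.
have hqq := nonneg_sqr sq.
have := norm_mono (nonnegD hqq hqq) (b := (1 + q) * q * (1 + q)).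
rewrite e3 => /(_ (nonnegD hq hqqq)).
rewrite -mulr2n -rscaleNat normZr norm_sqr // nq ger0_norm //; lra.
Qed.

Lemma star_mul_neg_eq0 y : nonneg (- (y^† * y)) -> y = 0.
Proof.
move=> hq; apply: norm_eq0; apply/eqP/negPn/negP => y0.
have yp : 0 < nrm y by rewrite lt_def y0 norm_ge0.
pose z := (nrm y)^-1 *r: y.
have z1 : nrm z = 1 by rewrite normZr ger0_norm ?invr_ge0 ?norm_ge0 // mulVf.
apply: (norm1_star_mul_not_neg z1); rewrite /z starZr -scalerAl -scalerAr.
rewrite rscaleA -scalerN; apply: nonnegZ => //.
by rewrite mulr_ge0 ?invr_ge0 ?norm_ge0.
Qed.

(* With [m = |a|] for [a = x^† x] and [n = m - a], the element [x n] satisfies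
   [(x n)^† (x n) = - n m n <= 0], hence vanishes, which forces [n = 0]. *)
Lemma nonneg_star_mul x : nonneg (x^† * x).
Proof.
pose a := x^† * x; have sa : a^† = a by rewrite starM starK.
have [m [em pm cm]] := nonneg_sqrt (nonneg_sqr sa).
have am : a * m = m * a by apply: cm; rewrite mulrA.
pose n := m - a; have sm := nonneg_sa pm.
have sn : n^† = n by rewrite starB sm sa.
have nm : n * m = m * n by rewrite mulrBl mulrBr am.
have an : a * n = - (m * n) by rewrite !mulrBr am em opprB.
have [g [eg pg cg]] := nonneg_sqrt pm.
have ng : n * g = g * n by apply: cg.
have xn0 : x * n = 0.
  apply: star_mul_neg_eq0; rewrite starM sn mulrA -[n * x^† * x]mulrA -/a -mulrA an.
  rewrite mulrN opprK -eg.
  have -> : n * (g * g * n) = (g * n) * (g * n) by rewrite !mulrA ng.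
  by apply: nonneg_sqr; rewrite starM sn (nonneg_sa pg) ng.
have an0 : a * n = 0 by rewrite -mulrA xn0 mulr0.
have mn0 : m * n = 0 by rewrite -[m * n]opprK -an an0 oppr0.
have n0 : n = 0 by apply: star_mul_eq0; rewrite sn {1}/n mulrBl an0 mn0 subrr.
by move/eqP: n0; rewrite subr_eq0 => /eqP e; rewrite -/a -e.
Qed.

Lemma nonneg_conj x a : nonneg a -> nonneg (x^† * a * x).
Proof.
move=> /nonneg_sqrt[h [<- /nonneg_sa sh _]].
have -> : x^† * (h * h) * x = (h * x)^† * (h * x) by rewrite starM sh !mulrA.
exact: nonneg_star_mul.
Qed.

Lemma nonneg_positive a : nonneg a <-> positive_elt a.
Proof.
split=> [/nonneg_sqrt[h [<- /nonneg_sa sh _]]|[b ->]]; last exact: nonneg_star_mul.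
by exists h; rewrite sh.
Qed.

Lemma nonneg_1subproj (q : A) : q^† = q -> q * q = q -> nonneg (1 - q).
Proof.
move=> sq qq; have -> : 1 - q = (1 - q)^† * (1 - q); last exact: nonneg_star_mul.
by rewrite starB star1 sq mulrBr mulr1 mulrBl mul1r qq subrr subr0.
Qed.

End StarSquares.

(** * Hilbert modules and the Cauchy-Schwarz inequality *)

Section HilbertModuleDef.
Variables (R : realType) (A : cstar_alg R).

Definition mod_norm (E : lmodType R[i]) (ip : E -> E -> A) (x : E) : R :=
  Num.sqrt (cs_nrm A (ip x x)).

(** The laws of a right module are consequences of [hm_ip_act], since the inner product separates
    points. The clause [hm_nonzero] provides [1 != 0] in the ring of operators. *)
Record is_hilbert_module (E : lmodType R[i]) (ip : E -> E -> A)
    (act : E -> A -> E) : Prop := IsHilbertModule {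
  hm_ipDr : forall x y z, ip x (y + z) = ip x y + ip x z;
  hm_ipZr : forall (k : R[i]) x y, ip x (k *: y) = k *: ip x y;
  hm_ip_star : forall x y, cs_star A (ip x y) = ip y x;
  hm_ip_act : forall x y a, ip x (act y a) = ip x y * a;
  hm_ip_nonneg : forall x, nonneg (ip x x);
  hm_ip_eq0 : forall x, ip x x = 0 -> x = 0;
  hm_complete : forall u : nat -> E, cauchy_seq (mod_norm ip) u ->
      exists l, converges_to (mod_norm ip) u l;
  hm_nonzero : exists x : E, x <> 0
}.

Record hilbert_module := HilbertModule {
  hm_car :> lmodType R[i];
  hm_ip : hm_car -> hm_car -> A;
  hm_act : hm_car -> A -> hm_car;
  hm_ax : is_hilbert_module hm_ip hm_act
}.

End HilbertModuleDef.

Arguments hm_ip {R A} h _ _.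
Arguments hm_act {R A} h _ _.

Section HilbertModule.
Variables (R : realType) (A : cstar_alg R) (E : hilbert_module A).
Local Notation "a ^†" := (cs_star A a) (at level 2, format "a ^†").
Local Notation nrm := (cs_nrm A).
Local Notation ip := (hm_ip E).
Local Notation hn := (mod_norm ip).
Implicit Types (x y z : E) (k : R[i]).

Lemma ipDr x y z : ip x (y + z) = ip x y + ip x z.
Proof. exact: (hm_ipDr (hm_ax E)). Qed.

Lemma ipZr k x y : ip x (k *: y) = k *: ip x y.
Proof. exact: (hm_ipZr (hm_ax E)). Qed.

Lemma ip_star x y : (ip x y)^† = ip y x.
Proof. exact: (hm_ip_star (hm_ax E)). Qed.

Lemma ip_nonneg x : nonneg (ip x x).
Proof. exact: (hm_ip_nonneg (hm_ax E)). Qed.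

Lemma ip_act x y a : ip x (hm_act E y a) = ip x y * a.
Proof. exact: (hm_ip_act (hm_ax E)). Qed.

Lemma ipDl x y z : ip (x + y) z = ip x z + ip y z.
Proof. by rewrite -ip_star ipDr starD !ip_star. Qed.

Lemma ipZl k x y : ip (k *: x) y = conjc k *: ip x y.
Proof. by rewrite -ip_star ipZr starZ ip_star. Qed.

Lemma ipNr x y : ip x (- y) = - ip x y.
Proof. by rewrite -scaleN1r ipZr scaleN1r. Qed.

Lemma ipNl x y : ip (- x) y = - ip x y.
Proof. by rewrite -ip_star ipNr starN ip_star. Qed.

Lemma ipBr x y z : ip x (y - z) = ip x y - ip x z.
Proof. by rewrite ipDr ipNr. Qed.

Lemma ipBl x y z : ip (x - y) z = ip x z - ip y z.
Proof. by rewrite ipDl ipNl. Qed.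

Lemma ip_actl x y a : ip (hm_act E x a) y = a^† * ip x y.
Proof. by rewrite -ip_star ip_act starM ip_star. Qed.

Lemma eq_of_ipl x y : (forall z, ip x z = ip y z) -> x = y.
Proof.
move=> h; apply/eqP; rewrite -subr_eq0; apply/eqP/(hm_ip_eq0 (hm_ax E)).
by rewrite ipBl !ipBr !h subrr.
Qed.

Lemma eq_of_ipr x y : (forall z, ip z x = ip z y) -> x = y.
Proof. by move=> h; apply: eq_of_ipl => z; rewrite -ip_star h ip_star. Qed.

Lemma mod_norm_ge0 x : 0 <= hn x. Proof. exact: sqrtr_ge0. Qed.

Lemma mod_norm_sqr x : hn x ^+ 2 = nrm (ip x x).
Proof. by rewrite sqr_sqrtr // norm_ge0. Qed.

Lemma mod_norm_eq0 x : hn x = 0 -> x = 0.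
Proof.
move=> h; apply/(hm_ip_eq0 (hm_ax E))/norm_eq0.
by rewrite -mod_norm_sqr h expr0n.
Qed.

Lemma mod_norm_le x (M : R) : 0 <= M -> nrm (ip x x) <= M ^+ 2 -> hn x <= M.
Proof.
by move=> M0; rewrite -mod_norm_sqr ler_pXn2r // nnegrE ?mod_norm_ge0.
Qed.

Lemma mod_normZ k x : hn (k *: x) = cmod k * hn x.
Proof.
rewrite /mod_norm ipZl ipZr scalerA conjcM_cmod normZr ger0_norm ?sqr_ge0 //.
by rewrite sqrtrM ?sqr_ge0 // sqrtr_sqr ger0_norm ?cmod_ge0.
Qed.

Lemma mod_normN x : hn (- x) = hn x.
Proof. by rewrite /mod_norm ipNl ipNr opprK. Qed.

Lemma mod_norm_distC x y : hn (x - y) = hn (y - x).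
Proof. by rewrite -mod_normN opprB. Qed.

(* Positivity of [<x a - y, x a - y>] for [a = <x, y> / |x|^2]. *)
Lemma cauchy_schwarz x y : nrm (ip x y) <= hn x * hn y.
Proof.
have [x0|x0] := eqVneq (hn x) 0.
  have -> : ip x y = 0.
    by rewrite (mod_norm_eq0 x0) -(scale0r x) ipZl conjc0 scale0r.
  by rewrite norm0 x0 mul0r.
have xp : 0 < hn x ^+ 2 by rewrite exprn_gt0 // lt_def x0 mod_norm_ge0.
set t := hn x ^+ 2 in xp; pose b := ip x y; pose a := t^-1 *r: b.
have sb : b^† = ip y x by rewrite ip_star.
have aa : a^† * (t *r: 1) * a = t^-1 *r: (b^† * b).
  rewrite -[a^† * _]scalerAr mulr1 [in a^†]/a starZr rscaleA mulfV ?gt_eqF //.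
  by rewrite rscale1 -scalerAr.
have h1 : nonneg (a^† * (t *r: 1) * a - a^† * ip x x * a).
  rewrite -mulrBl -mulrBr; apply: nonneg_conj.
  apply: nonneg_norm_sub; first exact: ip_star.
  by rewrite /t mod_norm_sqr.
have h2 := ip_nonneg (hm_act E x a - y).
rewrite ipBl !ipBr !ip_act !ip_actl -/b -sb in h2.
have e1 : a^† * b = t^-1 *r: (b^† * b) by rewrite /a starZr -scalerAl.
have e2 : b^† * a = t^-1 *r: (b^† * b) by rewrite /a -scalerAr.
rewrite e1 e2 in h2; rewrite aa in h1.
have h3 : nonneg (t *r: ip y y - b^† * b).
  have -> : t *r: ip y y - b^† * b = t *r: (ip y y - t^-1 *r: (b^† * b)).
    by rewrite scalerBr rscaleA mulfV ?gt_eqF // rscale1.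
  apply: nonnegZ; first exact: ltW.
  by move: (nonnegD h1 h2); rewrite addrA subrKA subrr add0r opprB.
have := norm_mono (nonneg_star_mul b) h3.
rewrite norm_star_mul normZr ger0_norm ?(ltW xp) // -mod_norm_sqr /t -exprMn.
by rewrite ler_pXn2r // nnegrE ?norm_ge0 // mulr_ge0 ?mod_norm_ge0.
Qed.

Lemma mod_normD x y : hn (x + y) <= hn x + hn y.
Proof.
apply: mod_norm_le; first by rewrite addr_ge0 ?mod_norm_ge0.
rewrite ipDl !ipDr; have := normD (ip x x + ip x y) (ip y x + ip y y).
have := normD (ip x x) (ip x y); have := normD (ip y x) (ip y y).
have := cauchy_schwarz x y; have := cauchy_schwarz y x.
by rewrite -!mod_norm_sqr; nra.
Qed.

Lemma mod_norm_dist_trans z x y : hn (x - y) <= hn (x - z) + hn (z - y).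
Proof. by rewrite -[x - y](subrKA z) mod_normD. Qed.

Lemma mod_cvg_ip (u : nat -> E) l y :
  converges_to hn u l -> converges_to nrm (fun n => ip (u n) y) (ip l y).
Proof.
move=> hu e e0; have y1 : 0 < hn y + 1 by rewrite ltr_wpDl ?mod_norm_ge0.
have [N hN] := hu (e / (hn y + 1)) (divr_gt0 e0 y1).
exists N => n /hN; rewrite ltr_pdivlMr // -ipBl.
by have := cauchy_schwarz (u n - l) y; have := mod_norm_ge0 (u n - l); nra.
Qed.

End HilbertModule.

(** * The C*-algebra of adjointable operators *)

Record adjop (R : realType) (A : cstar_alg R) (E : hilbert_module A) := AdjOp {
  adj_fun :> E -> E;
  adj_adj : E -> E;
  adjP : forall x y, hm_ip E (adj_fun x) y = hm_ip E x (adj_adj y);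
  adj_bounded : exists2 M, 0 <= M & forall x,
      mod_norm (hm_ip E) (adj_fun x) <= M * mod_norm (hm_ip E) x
}.

Section AdjointableOperators.
Local Open Scope classical_set_scope.
Variables (R : realType) (A : cstar_alg R) (E : hilbert_module A).
Local Notation nrm := (cs_nrm A).
Local Notation ip := (hm_ip E).
Local Notation hn := (mod_norm ip).
Implicit Types (S T : adjop E) (x y : E) (k : R[i]).

(** A bounded map on a Hilbert module need not have an adjoint, so the adjoint is stored;
    nondegeneracy of the inner product determines it. *)
Lemma adjop_eq S T : (forall x, S x = T x) -> S = T.
Proof.
case: S T => [S S' aS bS] [T T' aT bT] /= /funext eST; subst T.
have eST' : S' = T' by apply/funext => y; apply: eq_of_ipr => x; rewrite -aS aT.
by subst T'; congr AdjOp; apply: Prop_irrelevance.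
Qed.

Lemma adjP' T x y : ip x (T y) = ip (adj_adj T x) y.
Proof. by rewrite -ip_star adjP ip_star. Qed.

Lemma adj_funD T x y : T (x + y) = T x + T y.
Proof. by apply: eq_of_ipl => z; rewrite ipDl !adjP ipDl. Qed.

Lemma adj_funZ T k x : T (k *: x) = k *: T x.
Proof. by apply: eq_of_ipl => z; rewrite ipZl !adjP ipZl. Qed.

(** For [y = T^† x], the square of [hn y] is the norm of [<T y, x>], at most [M * hn y * hn x]. *)
Lemma adj_adj_bounded T (M : R) : 0 <= M -> (forall x, hn (T x) <= M * hn x) ->
  forall x, hn (adj_adj T x) <= M * hn x.
Proof.
move=> M0 hM x; set y := adj_adj T x.
have [y0|y0] := eqVneq (hn y) 0; first by rewrite y0 mulr_ge0 ?mod_norm_ge0.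
have yp : 0 < hn y by rewrite lt_def y0 mod_norm_ge0.
rewrite -(ler_pM2r yp) -expr2 mod_norm_sqr -adjP.
have := cauchy_schwarz (T y) x; have := hM y.
by have := mod_norm_ge0 x; nra.
Qed.

Lemma adj_star_proof T : exists2 M, 0 <= M & forall x, hn (adj_adj T x) <= M * hn x.
Proof.
by have [M M0 hM] := adj_bounded T; exists M => // x; apply: adj_adj_bounded.
Qed.

Definition adj_star T : adjop E := AdjOp (fun x y => esym (adjP' T x y)) (adj_star_proof T).

Lemma adj_add_adj S T x y : ip (S x + T x) y = ip x (adj_adj S y + adj_adj T y).
Proof. by rewrite ipDl ipDr !adjP. Qed.

Lemma adj_add_bounded S T : exists2 M, 0 <= M & forall x, hn (S x + T x) <= M * hn x.
Proof.
have [M M0 hM] := adj_bounded S; have [N N0 hN] := adj_bounded T.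
exists (M + N); first exact: addr_ge0.
move=> x; have := mod_normD (S x) (T x); have := hM x; have := hN x; nra.
Qed.

Definition adj_add S T : adjop E := AdjOp (adj_add_adj S T) (adj_add_bounded S T).

Lemma adj_scale_adj k T x y : ip (k *: T x) y = ip x (conjc k *: adj_adj T y).
Proof. by rewrite ipZl ipZr adjP. Qed.

Lemma adj_scale_bounded k T : exists2 M, 0 <= M & forall x, hn (k *: T x) <= M * hn x.
Proof.
have [M M0 hM] := adj_bounded T; exists (cmod k * M).
  by rewrite mulr_ge0 ?cmod_ge0.
by move=> x; rewrite mod_normZ -mulrA ler_wpM2l ?cmod_ge0.
Qed.

Definition adj_scale k T : adjop E := AdjOp (adj_scale_adj k T) (adj_scale_bounded k T).

Lemma adj_mul_adj S T x y : ip (S (T x)) y = ip x (adj_adj T (adj_adj S y)).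
Proof. by rewrite !adjP. Qed.

Lemma adj_mul_bounded S T : exists2 M, 0 <= M & forall x, hn (S (T x)) <= M * hn x.
Proof.
have [M M0 hM] := adj_bounded S; have [N N0 hN] := adj_bounded T.
exists (M * N); first exact: mulr_ge0.
by move=> x; rewrite (le_trans (hM _)) // -mulrA ler_wpM2l.
Qed.

Definition adj_mul S T : adjop E := AdjOp (adj_mul_adj S T) (adj_mul_bounded S T).

Lemma adj_one_bounded : exists2 M, 0 <= M & forall x, hn x <= M * hn x.
Proof. by exists 1 => // x; rewrite mul1r. Qed.

Definition adj_one : adjop E := @AdjOp R A E id id (fun _ _ => erefl) adj_one_bounded.

Definition adj_zero : adjop E := adj_scale 0 adj_one.

HB.instance Definition _ := gen_eqMixin (adjop E).
HB.instance Definition _ := gen_choiceMixin (adjop E).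

Lemma adj_addA : associative adj_add.
Proof. by move=> S T U; apply: adjop_eq => x /=; rewrite addrA. Qed.

Lemma adj_addC : commutative adj_add.
Proof. by move=> S T; apply: adjop_eq => x /=; rewrite addrC. Qed.

Lemma adj_add0 : left_id adj_zero adj_add.
Proof. by move=> S; apply: adjop_eq => x /=; rewrite scale0r add0r. Qed.

Lemma adj_addN : left_inverse adj_zero (adj_scale (-1)) adj_add.
Proof. by move=> S; apply: adjop_eq => x /=; rewrite scaleN1r addNr scale0r. Qed.

HB.instance Definition _ := GRing.isZmodule.Build (adjop E)
  adj_addA adj_addC adj_add0 adj_addN.

Lemma adj_mulA : associative adj_mul.
Proof. by move=> S T U; apply: adjop_eq. Qed.

Lemma adj_mul1 : left_id adj_one adj_mul.
Proof. by move=> S; apply: adjop_eq. Qed.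

Lemma adj_mulr1 : right_id adj_one adj_mul.
Proof. by move=> S; apply: adjop_eq. Qed.

Lemma adj_mulDl : left_distributive adj_mul adj_add.
Proof. by move=> S T U; apply: adjop_eq. Qed.

Lemma adj_mulDr : right_distributive adj_mul adj_add.
Proof. by move=> S T U; apply: adjop_eq => x /=; rewrite adj_funD. Qed.

Lemma adj_one_neq0 : adj_one != adj_zero.
Proof.
apply/eqP => e; have [x x0] := hm_nonzero (hm_ax E); apply: x0.
by rewrite -[x]/(adj_one x) e /= scale0r.
Qed.

HB.instance Definition _ := GRing.Zmodule_isNzRing.Build (adjop E)
  adj_mulA adj_mul1 adj_mulr1 adj_mulDl adj_mulDr adj_one_neq0.

Lemma adj_scaleA k l T : adj_scale k (adj_scale l T) = adj_scale (k * l) T.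
Proof. by apply: adjop_eq => x /=; rewrite scalerA. Qed.

Lemma adj_scale1 : left_id 1 adj_scale.
Proof. by move=> T; apply: adjop_eq => x /=; rewrite scale1r. Qed.

Lemma adj_scaleDr : right_distributive adj_scale +%R.
Proof. by move=> k S T; apply: adjop_eq => x /=; rewrite scalerDr. Qed.

Lemma adj_scaleDl T : {morph adj_scale^~ T : k l / k + l}.
Proof. by move=> k l; apply: adjop_eq => x /=; rewrite scalerDl. Qed.

HB.instance Definition _ := GRing.Zmodule_isLmodule.Build R[i] (adjop E)
  adj_scaleA adj_scale1 adj_scaleDr adj_scaleDl.

Lemma adj_scaleAl k S T : k *: (S * T) = k *: S * T.
Proof. exact: adjop_eq. Qed.

HB.instance Definition _ := GRing.Lmodule_isLalgebra.Build R[i] (adjop E) adj_scaleAl.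

Lemma adj_scaleAr k S T : k *: (S * T) = S * (k *: T).
Proof. by apply: adjop_eq => x /=; rewrite adj_funZ. Qed.

HB.instance Definition _ := GRing.Lalgebra_isAlgebra.Build R[i] (adjop E) adj_scaleAr.

Lemma adjD S T x : (S + T) x = S x + T x. Proof. by []. Qed.
Lemma adj0 x : (0 : adjop E) x = 0. Proof. exact: scale0r. Qed.
Lemma adjZ k T x : (k *: T) x = k *: T x. Proof. by []. Qed.
Lemma adjN T x : (- T) x = - T x. Proof. by rewrite -scaleN1r. Qed.
Lemma adjB S T x : (S - T) x = S x - T x. Proof. by rewrite adjD adjN. Qed.
Lemma adjM S T x : (S * T) x = S (T x). Proof. by []. Qed.

Definition op_norm T : R :=
  inf [set M | 0 <= M /\ forall x, hn (T x) <= M * hn x].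

Lemma op_norm_ge0 T : 0 <= op_norm T.
Proof.
apply: lb_le_inf => [|M [] //]; have [M M0 hM] := adj_bounded T.
by exists M.
Qed.

Lemma op_norm_le T (M : R) : 0 <= M -> (forall x, hn (T x) <= M * hn x) -> op_norm T <= M.
Proof. by move=> M0 hM; apply: ge_inf; [exists 0 => ? []|split]. Qed.

Lemma op_normP T x : hn (T x) <= op_norm T * hn x.
Proof.
have [x0|x0] := eqVneq (hn x) 0.
  by have [M _ /(_ x)] := adj_bounded T; rewrite x0 !mulr0.
have xp : 0 < hn x by rewrite lt_def x0 mod_norm_ge0.
rewrite -ler_pdivrMr //; apply: lb_le_inf.
  by have [M M0 hM] := adj_bounded T; exists M.
by move=> M [M0 hM]; rewrite ler_pdivrMr.
Qed.

Lemma op_norm_eq0 T : op_norm T = 0 -> T = 0.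
Proof.
move=> h; apply: adjop_eq => x; rewrite adj0; apply: mod_norm_eq0; apply/eqP.
by rewrite eq_le mod_norm_ge0 andbT; have := op_normP T x; rewrite h mul0r.
Qed.

Lemma op_normD S T : op_norm (S + T) <= op_norm S + op_norm T.
Proof.
apply: op_norm_le; first by rewrite addr_ge0 ?op_norm_ge0.
move=> x; rewrite mulrDl (le_trans (mod_normD _ _)) // lerD //; exact: op_normP.
Qed.

Lemma op_normM S T : op_norm (S * T) <= op_norm S * op_norm T.
Proof.
apply: op_norm_le; first by rewrite mulr_ge0 ?op_norm_ge0.
move=> x; rewrite adjM (le_trans (op_normP S _)) // -mulrA ler_wpM2l ?op_norm_ge0 //.
exact: op_normP.
Qed.

Lemma op_normZ k T : op_norm (k *: T) = cmod k * op_norm T.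
Proof.
have le l S : op_norm (l *: S) <= cmod l * op_norm S.
  apply: op_norm_le; first by rewrite mulr_ge0 ?cmod_ge0 ?op_norm_ge0.
  by move=> x; rewrite adjZ mod_normZ -mulrA ler_wpM2l ?cmod_ge0 ?op_normP.
apply/eqP; rewrite eq_le le /=.
have [k0|k0] := eqVneq k 0; first by rewrite k0 (cmod_real 0) normr0 mul0r op_norm_ge0.
have ckp : 0 < cmod k.
  by rewrite lt_def cmod_ge0 andbT; apply: contra_neq k0; apply: cmod_eq0.
rewrite -ler_pdivlMl // -{1}[T](scalerK k0) (le_trans (le _ _)) //.
by rewrite cmodE Normc.normcV -cmodE.
Qed.

Lemma op_norm_star_le T : op_norm (adj_star T) <= op_norm T.
Proof.
apply: op_norm_le (op_norm_ge0 T) _ => x /=.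
by apply: adj_adj_bounded (op_norm_ge0 T) _ x; apply: op_normP.
Qed.

(** The hard inequality is Cauchy-Schwarz applied to [<T x, T x> = <x, T^† T x>]. *)
Lemma op_norm_cstar T : op_norm (adj_star T * T) = op_norm T ^+ 2.
Proof.
apply/eqP; rewrite eq_le; apply/andP; split.
  rewrite (le_trans (op_normM _ _)) // expr2 ler_wpM2r ?op_norm_ge0 //.
  exact: op_norm_star_le.
set S := adj_star T * T; have S0 := op_norm_ge0 S.
rewrite -[X in _ <= X]sqr_sqrtr // lerXn2r ?nnegrE ?op_norm_ge0 ?sqrtr_ge0 //.
apply: op_norm_le (sqrtr_ge0 _) _ => x.
apply: mod_norm_le; first by rewrite mulr_ge0 ?sqrtr_ge0 ?mod_norm_ge0.
rewrite adjP exprMn sqr_sqrtr // -[adj_adj T (T x)]/(S x).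
have := cauchy_schwarz x (S x); have := op_normP S x; have := mod_norm_ge0 x; nra.
Qed.

Section Completeness.
Variable u : nat -> adjop E.
Hypothesis cu : cauchy_seq op_norm u.

Lemma adjop_cauchy_pt (x : E) : cauchy_seq hn (fun n => u n x).
Proof.
move=> e e0; have x1 : 0 < hn x + 1 by rewrite ltr_wpDl ?mod_norm_ge0.
have [N hN] := cu (divr_gt0 e0 x1); exists N => m n Nm Nn.
rewrite -adjB; have := hN m n Nm Nn; rewrite ltr_pdivlMr //.
by have := op_normP (u m - u n) x; have := op_norm_ge0 (u m - u n); nra.
Qed.

Lemma adjop_cauchy_star : cauchy_seq op_norm (fun n => adj_star (u n)).
Proof.
move=> e e0; have [N hN] := cu e0; exists N => m n Nm Nn.
apply: le_lt_trans (hN m n Nm Nn).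
have -> : adj_star (u m) - adj_star (u n) = adj_star (u m - u n).
  apply: adjop_eq => x; rewrite adjB.
  by rewrite -[RHS]/(adj_adj (u m) x + conjc (-1) *: adj_adj (u n) x) rmorphN1 scaleN1r.
exact: op_norm_star_le.
Qed.

End Completeness.

(** The adjoints form a Cauchy sequence too, and the pointwise limits of the two sequences are
    adjoint to each other. *)
Lemma op_norm_complete (u : nat -> adjop E) : cauchy_seq op_norm u ->
  exists T, converges_to op_norm u T.
Proof.
move=> cu.
have cvgS (v : nat -> adjop E) : cauchy_seq op_norm v ->
    {S : E -> E | forall x, converges_to hn (fun n => v n x) (S x)}.
  move=> cv; have h x := hm_complete (hm_ax E) (adjop_cauchy_pt cv x).
  by exists (fun x => projT1 (cid (h x))) => x; apply: projT2 (cid (h x)).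
have [S hS] := cvgS _ cu; have [S' hS'] := cvgS _ (adjop_cauchy_star cu).
have aS x y : ip (S x) y = ip x (S' y).
  apply: cvg_uniq (mod_cvg_ip y (hS x)) _.
  have := cvg_star (mod_cvg_ip x (hS' y)); rewrite ip_star.
  by rewrite (_ : (fun n => _) = fun n => ip (u n x) y) // funeqE => n;
    rewrite ip_star /= adjP.
(* The rank [N] comes from the operator norm and does not depend on [x]; only the auxiliary index
   [m], sent to infinity, does. *)
have dist e : 0 < e -> exists N, forall n x, (N <= n)%N -> hn (u n x - S x) <= e * hn x.
  move=> e0; have [N hN] := cu _ e0; exists N => n x Nn.
  apply/ler_addgt0Pr => d d0; have [N' hN'] := hS x _ d0.
  pose m := maxn N N'; have := hN' m (leq_maxr _ _).
  have := mod_norm_dist_trans (u m x) (u n x) (S x).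
  have := op_normP (u n - u m) x; rewrite adjB.
  have := hN n m Nn (leq_maxl _ _); have := mod_norm_ge0 x; nra.
have bS : exists2 M, 0 <= M & forall x, hn (S x) <= M * hn x.
  have [N hN] := dist 1 ltr01; exists (1 + op_norm (u N)).
    by rewrite addr_ge0 ?op_norm_ge0.
  move=> x; have := hN N x (leqnn N); have := op_normP (u N) x.
  have := mod_norm_dist_trans (u N x) 0 (S x).
  by rewrite sub0r mod_normN (mod_norm_distC 0) subr0; nra.
exists (AdjOp aS bS) => e e0; have e2 : 0 < e / 2 by rewrite divr_gt0.
have [N hN] := dist _ e2; exists N => n Nn.
apply: (@le_lt_trans _ _ (e / 2)); last by lra.
by apply: op_norm_le (ltW e2) _ => x; rewrite adjB hN.
Qed.

Lemma adjop_cstar : is_unital_cstar adj_star op_norm.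
Proof.
split.
- by move=> S T; apply: adjop_eq.
- by move=> k T; apply: adjop_eq.
- by move=> S T; apply: adjop_eq.
- by move=> T; apply: adjop_eq.
- exact: op_norm_ge0.
- exact: op_norm_eq0.
- exact: op_normD.
- exact: op_normZ.
- exact: op_normM.
- exact: op_norm_cstar.
- exact: op_norm_complete.
Qed.

Definition adjop_alg : cstar_alg R := CStarAlg adjop_cstar.

End AdjointableOperators.

(** * Unconditional sums in a C*-algebra *)

Section UnorderedSums.
Variables (R : realType) (A : cstar_alg R) (I : choiceType).
Local Notation nrm := (cs_nrm A).
Local Notation cvg := (converges_to nrm).
Implicit Types (f g : I -> A) (F : {fset I}) (l m : A).

(** Convergence along the net of finite subsets: the index group may be uncountable, and the series
    of norms may diverge. *)
Definition sums_to f l := forall e : R, 0 < e ->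
  exists F0 : {fset I}, forall F, (F0 `<=` F)%fset ->
    nrm (\sum_(i <- F) f i - l) < e.

Definition cauchy_sum f := forall e : R, 0 < e ->
  exists F0 : {fset I}, forall F, (forall i, i \in F -> i \notin F0) ->
    nrm (\sum_(i <- F) f i) < e.

Lemma sum_fset_sub f F F0 : (F0 `<=` F)%fset ->
  \sum_(i <- F) f i = \sum_(i <- F0) f i + \sum_(i <- (F `\` F0)%fset) f i.
Proof.
move=> sF; rewrite (big_fsetID _ (mem F0)) /=; congr (_ + _).
- congr (\sum_(i <- enum_fset _) _); apply/fsetP => i; rewrite !inE /=.
  by apply/andP/idP => [[]//|iF0]; split=> //; apply: (fsubsetP sF).
- congr (\sum_(i <- enum_fset _) _); apply/fsetP => i; rewrite !inE /=.
  by rewrite andbC.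
Qed.

Lemma invS_small (e : R) : 0 < e ->
  exists N, forall n, (N <= n)%N -> n.+1%:R^-1 < e :> R.
Proof.
move=> e0; have [N hN] : exists N : nat, e^-1 < N%:R.
  by exists (Num.truncn e^-1).+1; rewrite truncnS_gt.
exists N => n Nn; rewrite invf_plt ?posrE //.
by apply: lt_le_trans hN _; rewrite ler_nat leqW.
Qed.

(** Trades the net for a sequence, so that sequential closedness applies; keeping [F0] inside every
    [G n] gives comparisons with the partial sum over [F0]. *)
Lemma sums_to_seq f l F0 : sums_to f l ->
  exists2 G : nat -> {fset I}, (forall n, F0 `<=` G n)%fset &
    cvg (fun n => \sum_(i <- G n) f i) l.
Proof.
move=> h; have pos n : 0 < n.+1%:R^-1 :> R by rewrite invr_gt0 ltr0Sn.
exists (fun n => F0 `|` projT1 (cid (h _ (pos n))))%fset.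
  by move=> n; apply: fsubsetUl.
move=> e e0; have [N hN] := invS_small e0; exists N => n Nn.
apply: lt_trans (hN n Nn); apply: (projT2 (cid (h _ (pos n)))).
exact: fsubsetUr.
Qed.

Lemma sums_to_uniq f l m : sums_to f l -> sums_to f m -> l = m.
Proof.
move=> hl hm; apply: eq_of_norm_small => e e0.
have e2 : 0 < e / 2 by rewrite divr_gt0.
have [F1 h1] := hl _ e2; have [F2 h2] := hm _ e2.
have := h1 _ (fsubsetUl F1 F2); have := h2 _ (fsubsetUr F1 F2).
have := norm_dist_trans (\sum_(i <- (F1 `|` F2)%fset) f i) l m.
rewrite (norm_distC l (\sum_(_ <- _) _)); lra.
Qed.

Lemma sums_toD f g l m : sums_to f l -> sums_to g m ->
  sums_to (fun i => f i + g i) (l + m).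
Proof.
move=> hl hm e e0; have e2 : 0 < e / 2 by rewrite divr_gt0.
have [F1 h1] := hl _ e2; have [F2 h2] := hm _ e2.
exists (F1 `|` F2)%fset => F; rewrite fsubUset => /andP[/h1 l1 /h2 l2].
rewrite big_split /= opprD addrACA.
by apply: le_lt_trans (normD _ _) _; lra.
Qed.

Lemma sums_to_map (T : A -> A) (M : R) f l :
  {morph T : a b / a + b} -> (forall a, nrm (T a) <= M * nrm a) ->
  sums_to f l -> sums_to (fun i => T (f i)) (T l).
Proof.
move=> TD TM hf e e0.
have T0 : T 0 = 0 by apply: (addrI (T 0)); rewrite -TD !addr0.
have TB a b : T (a - b) = T a - T b.
  by apply: (addIr (T b)); rewrite -TD !subrK.
have M1 : 0 < `|M| + 1 by rewrite ltr_wpDl.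
have [F0 h] := hf _ (divr_gt0 e0 M1); exists F0 => F /h.
rewrite -(big_morph T TD T0) -TB ltr_pdivlMr //.
have := TM (\sum_(i <- F) f i - l); have := ler_norm M.
by have := norm_ge0 (\sum_(i <- F) f i - l); nra.
Qed.

Lemma sums_to_scale (k : R[i]) f l : sums_to f l -> sums_to (fun i => k *: f i) (k *: l).
Proof.
apply: (sums_to_map (M := cmod k)) => [a b|a]; first by rewrite scalerDr.
by rewrite normZ.
Qed.

Lemma sums_to_cauchy f l : sums_to f l -> cauchy_sum f.
Proof.
move=> hl e e0; have e2 : 0 < e / 2 by rewrite divr_gt0.
have [F0 h] := hl _ e2; exists F0 => F dF.
have := h _ (fsubset_refl F0); have := h _ (fsubsetUl F0 F).
rewrite (sum_fset_sub _ (fsubsetUl F0 F)).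
have -> : ((F0 `|` F) `\` F0 = F)%fset.
  apply/fsetP => i; rewrite !inE; case iF: (i \in F); last first.
    by rewrite orbF andNb.
  by rewrite orbT dF.
set a := \sum_(i <- F0) f i; set b := \sum_(i <- F) f i.
have := norm_dist_trans l (a + b) a; rewrite (addrC a b) addrK.
rewrite (norm_distC l a); lra.
Qed.

Lemma cauchy_sums_to f : cauchy_sum f -> exists l, sums_to f l.
Proof.
move=> cf; have pos n : 0 < n.+1%:R^-1 :> R by rewrite invr_gt0 ltr0Sn.
pose H n := projT1 (cid (cf _ (pos n))).
have hH n := projT2 (cid (cf _ (pos n))).
(* [H n] settles the tolerance [1 / (n + 1)]. Along the increasing unions [G n] the partial sums are
   Cauchy, and [near] compares any larger finite set with them. *)
pose G := fix G n := if n is m.+1 then (G m `|` H m.+1)%fset else H 0%N.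
have GH n : (H n `<=` G n)%fset by case: n => //= n; apply: fsubsetUr.
have GS (i j : nat) : (i <= j)%N -> (G i `<=` G j)%fset.
  elim: j => [|j IH]; first by rewrite leqn0 => /eqP ->; apply: fsubset_refl.
  rewrite leq_eqVlt => /orP[/eqP ->|]; first exact: fsubset_refl.
  by move=> /IH h; apply: fsubset_trans h (fsubsetUl _ _).
have near N F : (G N `<=` F)%fset ->
    nrm (\sum_(i <- F) f i - \sum_(i <- G N) f i) < N.+1%:R^-1.
  move=> sF; rewrite (sum_fset_sub _ sF) addrC addKr; apply: hH => i.
  by rewrite inE => /andP[iG _]; apply: contra iG; apply: (fsubsetP (GH N)).
have [|l hl] := @cauchy_seq_cvg R A (fun n => \sum_(i <- G n) f i).
  move=> e e0; have e2 : 0 < e / 2 by rewrite divr_gt0.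
  have [N hN] := invS_small e2; exists N => m n Nm Nn.
  have := near N _ (GS _ _ Nm); have := near N _ (GS _ _ Nn); have := hN N (leqnn N).
  have := norm_dist_trans (\sum_(i <- G N) f i) (\sum_(i <- G m) f i) (\sum_(i <- G n) f i).
  rewrite (norm_distC (\sum_(i <- G N) f i) (\sum_(i <- G n) f i)).
  by move: (N.+1%:R^-1) => d; lra.
exists l => e e0; have e2 : 0 < e / 2 by rewrite divr_gt0.
have [N hN] := invS_small e2; have [N' hN'] := hl _ e2.
exists (G (maxn N N')) => F /near; have := hN' _ (leq_maxr N N').
have := hN _ (leq_maxl N N').
have := norm_dist_trans (\sum_(i <- G (maxn N N')) f i) (\sum_(i <- F) f i) l.
by move: ((maxn N N').+1%:R^-1) => d; lra.
Qed.

Lemma cauchy_sumP f : cauchy_sum f <-> exists l, sums_to f l.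
Proof. by split=> [/cauchy_sums_to//|[l /sums_to_cauchy]]. Qed.

Lemma cauchy_sum_lin (k : R[i]) f g : cauchy_sum f -> cauchy_sum g ->
  cauchy_sum (fun i => k *: f i + g i).
Proof.
move=> /cauchy_sumP[l hl] /cauchy_sumP[m hm]; apply/cauchy_sumP.
by exists (k *: l + m); apply: sums_toD => //; apply: sums_to_scale.
Qed.

Lemma cauchy_sum_mono f g : (forall i, nonneg (f i)) ->
  (forall i, nonneg (g i - f i)) -> cauchy_sum g -> cauchy_sum f.
Proof.
move=> pf pfg cg e e0; have [F0 h] := cg _ e0; exists F0 => F /h.
apply: le_lt_trans; apply: norm_mono; first exact: nonneg_sum.
exact: nonneg_sub_sum.
Qed.

Lemma sums_to_partial_le f l F : (forall i, nonneg (f i)) -> sums_to f l ->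
  nonneg (l - \sum_(i <- F) f i).
Proof.
move=> pf hf; have [G sG hG] := sums_to_seq F hf.
apply: nonneg_closed (cvgD hG (cvg_cst _)) => n.
by rewrite (sum_fset_sub _ (sG n)) addrC addKr; apply: nonneg_sum.
Qed.

Lemma sums_to_nonneg f l : (forall i, nonneg (f i)) -> sums_to f l -> nonneg l.
Proof.
by move=> pf hf; have := sums_to_partial_le fset0 pf hf; rewrite big_seq_fset0 subr0.
Qed.

Lemma sums_to_norm_le f l (M : R) : sums_to f l ->
  (forall F, nrm (\sum_(i <- F) f i) <= M) -> nrm l <= M.
Proof.
by move=> hf hM; have [G _ hG] := sums_to_seq fset0 hf; apply: (cvg_norm_le (N := 0) hG).
Qed.

Lemma sums_to_reindex (s s' : I -> I) f l : cancel s s' -> cancel s' s ->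
  sums_to f l -> sums_to (fun i => f (s i)) l.
Proof.
move=> ss' s's hf e e0; have [F0 h] := hf _ e0.
exists [fset s' i | i in F0]%fset => F sF.
have -> : \sum_(i <- F) f (s i) = \sum_(j <- [fset s i | i in F]%fset) f j.
  by rewrite big_imfset // => i j _ _; apply: can_inj ss' _ _.
apply: h.
apply/fsubsetP => i iF0; rewrite -(s's i); apply: in_imfset => /=.
by apply: (fsubsetP sF); apply: in_imfset.
Qed.

End UnorderedSums.

(* The fibres of the direct sum are subspaces of [A] carrying their own inner
   product, not separate module types: operators which move the index then need
   no transport between fibre types. *)
Record is_fibres (R : realType) (A : cstar_alg R) (I : choiceType)
    (D : I -> A -> Prop) (fip : I -> A -> A -> A) (fact : I -> A -> A -> A) :
    Prop := IsFibres {
  fb_0 : forall i, D i 0;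
  fb_lin : forall i (k : R[i]) a b, D i a -> D i b -> D i (k *: a + b);
  fb_closed : forall i (u : nat -> A) a, (forall n, D i (u n)) ->
      converges_to (cs_nrm A) u a -> D i a;
  fb_act : forall i a c, D i a -> D i (fact i a c);
  fb_ipDr : forall i a b c, fip i a (b + c) = fip i a b + fip i a c;
  fb_ipZr : forall i (k : R[i]) a b, fip i a (k *: b) = k *: fip i a b;
  fb_ip_star : forall i a b, cs_star A (fip i a b) = fip i b a;
  fb_ip_act : forall i a b c, fip i a (fact i b c) = fip i a b * c;
  fb_ip_nonneg : forall i a, nonneg (fip i a a);
  fb_ip_bounded : forall i, exists M, forall a b,
      cs_nrm A (fip i a b) <= M * (cs_nrm A a * cs_nrm A b);
  fb_norm : forall i a, D i a -> cs_nrm A (fip i a a) = cs_nrm A a ^+ 2;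
  fb_nonzero : exists i a, D i a /\ a <> 0
}.

Record fibres (R : realType) (A : cstar_alg R) (I : choiceType) := Fibres {
  fb_in : I -> A -> Prop;
  fb_ip : I -> A -> A -> A;
  fb_mul : I -> A -> A -> A;
  fb_ax : is_fibres fb_in fb_ip fb_mul
}.

(** The sum of the inner squares has to converge in [A], which is weaker than summability of the
    squared norms and is what completeness for the module norm calls for. *)
Record l2 (R : realType) (A : cstar_alg R) (I : choiceType) (B : fibres A I) := L2 {
  l2_fun :> I -> A;
  l2_in : forall i, fb_in B i (l2_fun i);
  l2_sum : cauchy_sum (fun i => fb_ip B i (l2_fun i) (l2_fun i))
}.

(** * The l2 direct sum of the fibres *)

Section L2Module.
Variables (R : realType) (A : cstar_alg R) (I : choiceType) (B : fibres A I).
Local Notation "a ^†" := (cs_star A a) (at level 2, format "a ^†").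
Local Notation nrm := (cs_nrm A).
Local Notation D := (fb_in B).
Local Notation fip := (fb_ip B).
Local Notation ax := (fb_ax B).
Implicit Types (xi eta : l2 B) (a b c : A) (k : R[i]).

Lemma l2_eq xi eta : (forall i, xi i = eta i) -> xi = eta.
Proof.
case: xi eta => [f f1 f2] [g g1 g2] /= /funext e; subst g.
by congr L2; apply: Prop_irrelevance.
Qed.

Lemma fipDr i a b c : fip i a (b + c) = fip i a b + fip i a c.
Proof. exact: (fb_ipDr ax). Qed.

Lemma fipZr i k a b : fip i a (k *: b) = k *: fip i a b.
Proof. exact: (fb_ipZr ax). Qed.

Lemma fip_star i a b : (fip i a b)^† = fip i b a.
Proof. exact: (fb_ip_star ax). Qed.

Lemma fip_act i a b c : fip i a (fb_mul B i b c) = fip i a b * c.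
Proof. exact: (fb_ip_act ax). Qed.

Lemma fip_nonneg i a : nonneg (fip i a a).
Proof. exact: (fb_ip_nonneg ax). Qed.

Lemma fipDl i a b c : fip i (a + b) c = fip i a c + fip i b c.
Proof. by rewrite -fip_star fipDr starD !fip_star. Qed.

Lemma fipZl i k a b : fip i (k *: a) b = conjc k *: fip i a b.
Proof. by rewrite -fip_star fipZr starZ fip_star. Qed.

Lemma fip_actl i a b c : fip i (fb_mul B i a c) b = c^† * fip i a b.
Proof. by rewrite -fip_star fip_act starM fip_star. Qed.

Lemma fipNr i a b : fip i a (- b) = - fip i a b.
Proof. by rewrite -scaleN1r fipZr scaleN1r. Qed.

Lemma fipNl i a b : fip i (- a) b = - fip i a b.
Proof. by rewrite -fip_star fipNr starN fip_star. Qed.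

Lemma fipNN i a b : fip i (- a) (- b) = fip i a b.
Proof. by rewrite fipNl fipNr opprK. Qed.

Lemma fip0 i : fip i 0 0 = 0.
Proof. by have := fipZr i 0 0 0; rewrite !scale0r. Qed.

(** Parallelogram law: the difference is [<a - b, a - b>]. *)
Lemma fipDD_le i a b :
  nonneg (2 *r: fip i a a + 2 *r: fip i b b - fip i (a + b) (a + b)).
Proof.
suff -> : 2 *r: fip i a a + 2 *r: fip i b b - fip i (a + b) (a + b) =
    fip i (a - b) (a - b) by apply: fip_nonneg.
have sum4 : fip i (a + b) (a + b) + fip i (a - b) (a - b) =
    2 *r: fip i a a + 2 *r: fip i b b.
  rewrite !fipDl !fipDr fipNN !rscaleNat !mulr2n.
  rewrite fipNr fipNl addrACA; congr (_ + _).
    by rewrite addrACA subrr addr0.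
  by rewrite addrACA subrr add0r.
by rewrite -sum4 addrC addKr.
Qed.

Lemma l2_zero_sum : cauchy_sum (fun i => fip i 0 0).
Proof.
move=> e e0; exists fset0 => F _; rewrite big1 ?norm0 // => j _; exact: fip0.
Qed.

Lemma cauchy_sum_fipD (f g : I -> A) :
  cauchy_sum (fun i => fip i (f i) (f i)) -> cauchy_sum (fun i => fip i (g i) (g i)) ->
  cauchy_sum (fun i => fip i (f i + g i) (f i + g i)).
Proof.
move=> cf cg; apply: cauchy_sum_mono (fun i => fip_nonneg _ _) _ _.
- by move=> i; apply: fipDD_le.
- have c0 : cauchy_sum (fun _ : I => 0 : A).
    by move=> e e0; exists fset0 => F _; rewrite big1 ?norm0.
  have := cauchy_sum_lin (2%:C)%C cf (cauchy_sum_lin (2%:C)%C cg c0).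
  by under eq_fun do rewrite addr0.
Qed.

Lemma cauchy_sum_fipZ k (f : I -> A) : cauchy_sum (fun i => fip i (f i) (f i)) ->
  cauchy_sum (fun i => fip i (k *: f i) (k *: f i)).
Proof.
move=> /cauchy_sumP[l hl]; apply/cauchy_sumP; exists ((conjc k * k) *: l).
by under eq_fun do rewrite fipZl fipZr scalerA; apply: sums_to_scale.
Qed.

Lemma l2_lin_in k xi eta i : D i (k *: xi i + eta i).
Proof. by apply: (fb_lin ax); apply: l2_in. Qed.

Definition l2_zero : l2 B := L2 (fb_0 ax) l2_zero_sum.

Lemma l2_add_in xi eta i : D i (xi i + eta i).
Proof. by have := l2_lin_in 1 xi eta i; rewrite scale1r. Qed.

Definition l2_add xi eta : l2 B :=
  L2 (l2_add_in xi eta) (cauchy_sum_fipD (l2_sum xi) (l2_sum eta)).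

Lemma l2_scale_in k xi i : D i (k *: xi i).
Proof. by have := l2_lin_in k xi l2_zero i; rewrite addr0. Qed.

Definition l2_scale k xi : l2 B :=
  L2 (l2_scale_in k xi) (cauchy_sum_fipZ k (l2_sum xi)).

HB.instance Definition _ := gen_eqMixin (l2 B).
HB.instance Definition _ := gen_choiceMixin (l2 B).

Lemma l2_addA : associative l2_add.
Proof. by move=> x y z; apply: l2_eq => i /=; rewrite addrA. Qed.

Lemma l2_addC : commutative l2_add.
Proof. by move=> x y; apply: l2_eq => i /=; rewrite addrC. Qed.

Lemma l2_add0 : left_id l2_zero l2_add.
Proof. by move=> x; apply: l2_eq => i /=; rewrite add0r. Qed.

Lemma l2_addN : left_inverse l2_zero (l2_scale (-1)) l2_add.
Proof. by move=> x; apply: l2_eq => i /=; rewrite scaleN1r addNr. Qed.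

HB.instance Definition _ := GRing.isZmodule.Build (l2 B)
  l2_addA l2_addC l2_add0 l2_addN.

Lemma l2_scaleA k l xi : l2_scale k (l2_scale l xi) = l2_scale (k * l) xi.
Proof. by apply: l2_eq => i /=; rewrite scalerA. Qed.

Lemma l2_scale1 : left_id 1 l2_scale.
Proof. by move=> x; apply: l2_eq => i /=; rewrite scale1r. Qed.

Lemma l2_scaleDr : right_distributive l2_scale +%R.
Proof. by move=> k x y; apply: l2_eq => i /=; rewrite scalerDr. Qed.

Lemma l2_scaleDl xi : {morph l2_scale^~ xi : k l / k + l}.
Proof. by move=> k l; apply: l2_eq => i /=; rewrite scalerDl. Qed.

HB.instance Definition _ := GRing.Zmodule_isLmodule.Build R[i] (l2 B)
  l2_scaleA l2_scale1 l2_scaleDr l2_scaleDl.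

Lemma l2D xi eta i : (xi + eta) i = xi i + eta i. Proof. by []. Qed.
Lemma l2Z k xi i : (k *: xi) i = k *: xi i. Proof. by []. Qed.
Lemma l2N xi i : (- xi) i = - xi i. Proof. exact: scaleN1r. Qed.
Lemma l2B xi eta i : (xi - eta) i = xi i - eta i. Proof. by rewrite l2D l2N. Qed.

Lemma cauchy_sum_act c (f : I -> A) : cauchy_sum (fun i => fip i (f i) (f i)) ->
  cauchy_sum (fun i => fip i (fb_mul B i (f i) c) (fb_mul B i (f i) c)).
Proof.
move=> /cauchy_sumP[l hl]; apply/cauchy_sumP; exists (c^† * l * c).
under eq_fun do rewrite fip_act fip_actl.
apply: (sums_to_map (T := fun a => c^† * a * c) (M := nrm c ^+ 2)) hl.
  by move=> a b; rewrite mulrDr mulrDl.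
move=> a; rewrite (le_trans (normM _ _)) // (le_trans (ler_wpM2r _ (normM _ _))) //.
  exact: norm_ge0.
by rewrite norm_star mulrAC expr2.
Qed.

Definition l2_act xi c : l2 B :=
  L2 (fun i => fb_act ax c (l2_in xi i)) (cauchy_sum_act c (l2_sum xi)).

(* Polarisation reduces the summability of [<xi_i, eta_i>] to that of squares. *)
Lemma fip_polar i a b : fip i a b =
  2^-1 *r: (fip i (a + b) (a + b) - fip i a a - fip i b b) -
  ('i)%C *: (2^-1 *r: (fip i (a + ('i)%C *: b) (a + ('i)%C *: b) - fip i a a - fip i b b)).
Proof.
have ii : ('i * 'i = -1 :> R[i])%C by rewrite -expr2 sqr_i.
have cross (p q r s : A) : p + q + (r + s) - p - s = q + r.
  by apply/eqP; rewrite -addrA -opprD subr_eq [p + q]addrC addrACA.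
have q1 : fip i (a + b) (a + b) - fip i a a - fip i b b = fip i a b + fip i b a.
  by rewrite fipDl !fipDr cross.
have q2 : fip i (a + ('i)%C *: b) (a + ('i)%C *: b) - fip i a a - fip i b b =
    ('i)%C *: (fip i a b - fip i b a).
  rewrite fipDl !fipDr !fipZl !fipZr scalerA conjc_i mulNr ii opprK scale1r.
  by rewrite cross scalerBr scaleNr.
rewrite q1 q2 !scalerA mulrAC ii mulN1r scaleNr opprK -scalerDr addrACA subrr addr0.
exact: esym (rscale_half _).
Qed.

Lemma l2_ip_cauchy xi eta : cauchy_sum (fun i => fip i (xi i) (eta i)).
Proof.
have q (x : l2 B) : exists l, sums_to (fun i => fip i (x i) (x i)) l.
  by apply/cauchy_sumP/l2_sum.
have opp (f : I -> A) l : sums_to f l -> sums_to (fun i => - f i) (- l).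
  by move=> /(sums_to_scale (-1)); rewrite scaleN1r; under eq_fun do rewrite scaleN1r.
have [l1 h1] := q (xi + eta); have [l2 h2] := q xi; have [l3 h3] := q eta.
have [l4 h4] := q (xi + ('i)%C *: eta).
have s1 := sums_to_scale (2^-1%:C)%C (sums_toD (sums_toD h1 (opp _ _ h2)) (opp _ _ h3)).
have s2 := sums_to_scale (2^-1%:C)%C (sums_toD (sums_toD h4 (opp _ _ h2)) (opp _ _ h3)).
apply/cauchy_sumP; eexists.
under eq_fun do rewrite fip_polar.
exact: sums_toD s1 (opp _ _ (sums_to_scale _ s2)).
Qed.

Definition l2_ip xi eta : A := projT1 (cid (cauchy_sums_to (l2_ip_cauchy xi eta))).

Lemma l2_ipP xi eta : sums_to (fun i => fip i (xi i) (eta i)) (l2_ip xi eta).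
Proof. exact: projT2 (cid (cauchy_sums_to (l2_ip_cauchy xi eta))). Qed.

Local Notation hn := (mod_norm l2_ip).

Lemma l2_ip_partial_norm xi (F : {fset I}) :
  nrm (\sum_(i <- F) fip i (xi i) (xi i)) <= nrm (l2_ip xi xi).
Proof.
apply: norm_mono; first by apply: nonneg_sum => i; apply: fip_nonneg.
by apply: sums_to_partial_le (l2_ipP _ _) => i; apply: fip_nonneg.
Qed.

Lemma l2_coord_le xi i : nrm (xi i) <= hn xi.
Proof.
rewrite -(ler_pXn2r (ltn0Sn 1)) ?nnegrE ?norm_ge0 ?sqrtr_ge0 //.
rewrite sqr_sqrtr ?norm_ge0 // -(fb_norm ax (l2_in xi i)).
by have := l2_ip_partial_norm xi [fset i]%fset; rewrite big_seq_fset1.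
Qed.

Lemma fip_cvg i (u : nat -> A) a : converges_to nrm u a ->
  converges_to nrm (fun n => fip i (u n) (u n)) (fip i a a).
Proof.
move=> hu; have [M hM] := fb_ip_bounded ax i.
have [N hN] := hu 1 ltr01.
have M0 : 0 <= `|M| by [].
(* Once [nrm (u n) <= nrm a + 1], the two cross terms are at most [|M| (2 nrm a + 1)] times
   [nrm (u n - a)]; the last 1 keeps [K] positive. *)
move=> e e0; pose K := `|M| * (2 * nrm a + 1) + 1.
have K0 : 0 < K by rewrite /K; have := norm_ge0 a; nra.
have [N' hN'] := hu _ (divr_gt0 e0 K0).
exists (maxn N N') => n; rewrite geq_max => /andP[/hN n1 /hN'].
rewrite ltr_pdivlMr //; set d := u n - a in n1 *.
have -> : fip i (u n) (u n) - fip i a a = fip i d (u n) + fip i a d.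
  by rewrite /d fipDl fipDr fipNr fipNl addrA subrK.
have bd x y : nrm (fip i x y) <= `|M| * (nrm x * nrm y).
  by rewrite (le_trans (hM _ _)) // ler_wpM2r ?mulr_ge0 ?norm_ge0 // ler_norm.
have un : nrm (u n) <= nrm a + 1.
  by have := norm_dist_trans a (u n) 0; rewrite !subr0 -/d; lra.
have h1 : nrm d * nrm (u n) <= nrm d * (nrm a + 1).
  by rewrite ler_wpM2l ?norm_ge0.
have h2 : `|M| * (nrm d * nrm (u n)) <= `|M| * (nrm d * (nrm a + 1)).
  by rewrite ler_wpM2l.
have := normD (fip i d (u n)) (fip i a d).
have := bd d (u n); have := bd a d; have := norm_ge0 d.
rewrite /K; nra.
Qed.

Lemma l2_complete (u : nat -> l2 B) : cauchy_seq hn u ->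
  exists xi, converges_to hn u xi.
Proof.
move=> cu.
have cpt i : exists l, converges_to nrm (fun n => u n i) l.
  apply: cauchy_seq_cvg => e e0; have [N hN] := cu _ e0; exists N => m n Nm Nn.
  by rewrite -l2B (le_lt_trans (l2_coord_le _ _)) ?hN.
pose v i := projT1 (cid (cpt i)).
have hv i : converges_to nrm (fun n => u n i) (v i) by apply: projT2 (cid (cpt i)).
have vD i : D i (v i) by apply: (fb_closed ax (u := fun n => u n i)) (hv i) => n; apply: l2_in.
(* Fatou's argument: bound the finite sums for [u n - u m] uniformly in [F], then let [m] grow with
   [F] fixed. *)
have close e : 0 < e -> exists N, forall n, (N <= n)%N -> forall F : {fset I},
    nrm (\sum_(i <- F) fip i (u n i - v i) (u n i - v i)) <= e ^+ 2.
  move=> e0; have [N hN] := cu _ e0; exists N => n Nn F.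
  apply: (cvg_norm_le (N := N)
    (u := fun m => \sum_(i <- F) fip i (u n i - u m i) (u n i - u m i))).
    apply: cvg_sum => i; apply: (@fip_cvg i (fun m => u n i - u m i)).
    exact: cvgD (cvg_cst _) (cvgN (hv i)).
  move=> m Nm; have := l2_ip_partial_norm (u n - u m) F.
  under eq_bigr do rewrite l2B.
  move=> h; apply: le_trans h _; have := hN n m Nn Nm; set z := u n - u m => /ltW le_e.
  have -> : nrm (l2_ip z z) = hn z ^+ 2 by rewrite sqr_sqrtr ?norm_ge0.
  by rewrite lerXn2r ?nnegrE ?sqrtr_ge0 ?(ltW e0).
have vsum : cauchy_sum (fun i => fip i (v i) (v i)).
  (* The parallelogram bound for [v = u N - (u N - v)] doubles both tails, and two doubled terms of
     size [e / 8] stay below [e]. *)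
  move=> e e0; pose d := Num.sqrt (e / 8); have e8 : 0 < e / 8 by rewrite divr_gt0.
  have d0 : 0 < d by rewrite sqrtr_gt0.
  have d2 : d ^+ 2 = e / 8 by rewrite sqr_sqrtr // ltW.
  have [N hN] := close d d0; have [F0 hF0] := l2_sum (u N) e8.
  exists F0 => F /hF0 h1; have h2 := hN N (leqnn N) F; rewrite d2 in h2.
  have h3 : nrm (\sum_(i <- F) fip i (v i) (v i)) <=
     nrm (\sum_(i <- F) (2 *r: fip i (u N i) (u N i) +
        2 *r: fip i (u N i - v i) (u N i - v i))).
    apply: norm_mono; first by apply: nonneg_sum => i; apply: fip_nonneg.
    apply: nonneg_sub_sum => i.
    by have := fipDD_le i (u N i) (- (u N i - v i)); rewrite fipNN subKr.
  apply: le_lt_trans h3 _; rewrite big_split /= -!scaler_sumr.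
  rewrite (le_lt_trans (normD _ _)) // !normZr ger0_norm //; lra.
exists (L2 vD vsum) => e e0; have e2 : 0 < e / 2 by rewrite divr_gt0.
have [N hN] := close _ e2; exists N => n Nn.
apply: (@le_lt_trans _ _ (e / 2)); last by lra.
rewrite -[leRHS]ger0_norm ?(ltW e2) // -sqrtr_sqr ler_sqrt ?sqr_ge0 //.
apply: sums_to_norm_le (l2_ipP _ _) _ => F.
by under eq_bigr do rewrite l2B; apply: hN.
Qed.

Section Delta.
Variables (i : I) (a : A) (Da : D i a).

Definition delta_fun j := if j == i then a else 0.

Lemma delta_in j : D j (delta_fun j).
Proof. by rewrite /delta_fun; case: eqP => [->//|_]; apply: (fb_0 ax). Qed.

Lemma delta_sum : cauchy_sum (fun j => fip j (delta_fun j) (delta_fun j)).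
Proof.
move=> e e0; exists [fset i]%fset => F hF; rewrite big_seq big1 ?norm0 // => j /hF.
by rewrite inE /delta_fun => /negbTE ->; apply: fip0.
Qed.

Definition l2_delta : l2 B := L2 delta_in delta_sum.

Lemma l2_deltaE : l2_delta i = a.
Proof. by rewrite /= /delta_fun eqxx. Qed.

End Delta.

Lemma l2_nonzero : exists xi : l2 B, xi <> 0.
Proof.
have [i [a [Da a0]]] := fb_nonzero ax; exists (l2_delta Da).
by move=> /(congr1 (fun x : l2 B => x i)); rewrite l2_deltaE.
Qed.

Lemma l2_hilbert : is_hilbert_module l2_ip l2_act.
Proof.
split.
- move=> x y z; apply: sums_to_uniq (l2_ipP _ _) _.
  by under eq_fun do rewrite l2D fipDr; apply: sums_toD; apply: l2_ipP.
- move=> k x y; apply: sums_to_uniq (l2_ipP _ _) _.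
  by under eq_fun do rewrite l2Z fipZr; apply: sums_to_scale; apply: l2_ipP.
- move=> x y; apply: sums_to_uniq (l2_ipP _ _).
  under eq_fun do rewrite -fip_star.
  apply: (sums_to_map (M := 1)) (l2_ipP _ _) => [a b|a]; first exact: starD.
  by rewrite norm_star mul1r.
- move=> x y c; apply: sums_to_uniq (l2_ipP _ _) _.
  under eq_fun do rewrite /= fip_act.
  apply: (sums_to_map (T := fun a => a * c) (M := nrm c)) (l2_ipP _ _) => [a b|a].
    exact: mulrDl.
  by rewrite mulrC normM.
- by move=> x; apply: sums_to_nonneg (l2_ipP _ _) => i; apply: fip_nonneg.
- move=> x x0; apply: l2_eq => i; apply: norm_eq0; apply/eqP.
  rewrite eq_le norm_ge0 andbT (le_trans (l2_coord_le x i)) //.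
  by rewrite /mod_norm x0 norm0 sqrtr0.
- exact: l2_complete.
- exact: l2_nonzero.
Qed.

Definition l2_module : hilbert_module A := HilbertModule l2_hilbert.

End L2Module.

(** * Operators that permute the fibres with weights *)

Section WeightedShift.
Variables (R : realType) (A : cstar_alg R) (I : choiceType) (B : fibres A I).
Local Notation nrm := (cs_nrm A).
Local Notation D := (fb_in B).
Local Notation fip := (fb_ip B).

Section Forward.
Variables (s s' : I -> I) (t : I -> A -> A) (M : R).
Hypotheses (ss' : cancel s s') (s's : cancel s' s) (M0 : 0 <= M).
Hypothesis t_in : forall j a, D (s' j) a -> D j (t j a).
Hypothesis t_le : forall j a, D (s' j) a ->
  nonneg (M *r: fip (s' j) a a - fip j (t j a) (t j a)).

Lemma shift_sum (xi : l2 B) :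
  cauchy_sum (fun j => fip j (t j (xi (s' j))) (t j (xi (s' j)))).
Proof.
apply: cauchy_sum_mono (fun j => fip_nonneg _ _ _) (fun j => t_le (l2_in xi (s' j))) _.
apply/cauchy_sumP; exists (M *r: l2_ip xi xi); apply: sums_to_scale.
exact: (sums_to_reindex (f := fun i => fip i (xi i) (xi i)) s's ss' (l2_ipP xi xi)).
Qed.

Definition shift_fun (xi : l2 B) : l2 B :=
  L2 (fun j => t_in (l2_in xi (s' j))) (shift_sum xi).

Lemma shift_bounded : exists2 K, 0 <= K & forall xi : l2_module B,
  mod_norm (hm_ip (l2_module B)) (shift_fun xi) <= K * mod_norm (hm_ip (l2_module B)) xi.
Proof.
exists (Num.sqrt M) => [|xi]; first exact: sqrtr_ge0.
rewrite /mod_norm -sqrtrM // ler_sqrt ?mulr_ge0 ?norm_ge0 //.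
rewrite -[X in _ <= X * _](ger0_norm M0) -normZr.
apply: norm_mono; first exact: ip_nonneg.
have h := sums_to_scale (M%:C)%C
  (sums_to_reindex (f := fun i => fip i (xi i) (xi i)) s's ss' (l2_ipP xi xi)).
have h' := sums_toD h (sums_to_scale (-1) (l2_ipP (shift_fun xi) (shift_fun xi))).
rewrite -[X in _ - X]scale1r -scaleNr; apply: sums_to_nonneg h' => j.
by rewrite scaleN1r; apply: t_le; apply: l2_in.
Qed.

End Forward.

Variables (s s' : I -> I) (t t' : I -> A -> A) (M M' : R).
Hypotheses (ss' : cancel s s') (s's : cancel s' s) (M0 : 0 <= M) (M'0 : 0 <= M').
Hypothesis t_in : forall j a, D (s' j) a -> D j (t j a).
Hypothesis t_le : forall j a, D (s' j) a ->
  nonneg (M *r: fip (s' j) a a - fip j (t j a) (t j a)).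
Hypothesis t'_in : forall i a, D (s i) a -> D i (t' i a).
Hypothesis t'_le : forall i a, D (s i) a ->
  nonneg (M' *r: fip (s i) a a - fip i (t' i a) (t' i a)).
Hypothesis t_adj : forall j a b, D (s' j) a -> D j b ->
  fip j (t j a) b = fip (s' j) a (t' (s' j) b).

Lemma shift_adj (xi eta : l2_module B) :
  hm_ip (l2_module B) (shift_fun ss' s's t_in t_le xi) eta =
  hm_ip (l2_module B) xi (shift_fun s's ss' t'_in t'_le eta).
Proof.
apply: sums_to_uniq (l2_ipP _ _) _.
have := sums_to_reindex s's ss' (l2_ipP xi (shift_fun s's ss' t'_in t'_le eta)).
congr sums_to; apply/funext => j /=.
by rewrite s's t_adj //; apply: l2_in.
Qed.

(** Gives both the algebra, with [s] the identity, and [U], with [s] a translation. Each weight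
    [t j] or [t' i] is indexed by the fibre in which it lands. *)
Definition shift_op : adjop (l2_module B) :=
  AdjOp shift_adj (shift_bounded ss' s's M0 t_in t_le).

End WeightedShift.

(** * Positive linear maps *)

Section PositiveMaps.
Variables (R : realType) (A : cstar_alg R) (T : A -> A).
Local Notation "a ^†" := (cs_star A a) (at level 2, format "a ^†").
Local Notation nrm := (cs_nrm A).
Hypothesis bT : bpl_map T.
Implicit Types (a b : A) (k : R[i]).

Lemma bplD a b : T (a + b) = T a + T b.
Proof. by case: bT => lT _ _; have := lT 1 a b; rewrite !scale1r. Qed.

Lemma bpl0 : T 0 = 0.
Proof. by apply: (addrI (T 0)); rewrite -bplD !addr0. Qed.

Lemma bplZ k a : T (k *: a) = k *: T a.
Proof. by case: bT => lT _ _; have := lT k a 0; rewrite !addr0 bpl0 addr0. Qed.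

Lemma bplN a : T (- a) = - T a.
Proof. by rewrite -scaleN1r bplZ scaleN1r. Qed.

Lemma bplB a b : T (a - b) = T a - T b.
Proof. by rewrite bplD bplN. Qed.

Lemma bpl_nonneg a : nonneg a -> nonneg (T a).
Proof. by case: bT => _ _ pT /nonneg_positive /pT /nonneg_positive. Qed.

(** A self-adjoint [a] is the difference of the nonnegative elements [nrm a] and [nrm a - a]. *)
Lemma bpl_sa a : a^† = a -> (T a)^† = T a.
Proof.
move=> sa; have -> : a = nrm a *r: 1 - (nrm a *r: 1 - a) by rewrite subKr.
rewrite bplB starB; congr (_ - _); apply: nonneg_sa; apply: bpl_nonneg.
  by apply: nonneg_rscalar; apply: norm_ge0.
exact: nonneg_norm_sub.
Qed.

Lemma bpl_star a : T a^† = (T a)^†.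
Proof.
pose x := a + a^†; pose y := ('i)%C *: (a - a^†).
have sx : x^† = x by rewrite starD starK addrC.
have sy : y^† = y by rewrite starZ starB starK conjc_i scaleNr -scalerN opprB.
have ii : ('i * 'i = -1 :> R[i])%C by rewrite -expr2 sqr_i.
have ea : a + a = x - ('i)%C *: y.
  by rewrite scalerA ii scaleN1r opprK addrACA subrr addr0.
have es : a^† + a^† = x + ('i)%C *: y.
  by rewrite scalerA ii scaleN1r opprB [RHS]addrC subrKA.
rewrite -[LHS]rscale_half -[RHS]rscale_half; congr (_ *: _).
rewrite -bplD es -starD -bplD ea bplB bplD bplZ starB starZ.
by rewrite (bpl_sa sx) (bpl_sa sy) conjc_i scaleNr opprK.
Qed.

Lemma bpl_le_unit a : nonneg a -> nonneg (nrm a *r: T 1 - T a).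
Proof.
move=> pa; rewrite -bplZ -bplB; apply: bpl_nonneg.
exact: nonneg_norm_sub (nonneg_sa pa) (lexx _).
Qed.

End PositiveMaps.

(** * The images of 1 under an interaction *)

Section InteractionPair.
Variables (R : realType) (A : cstar_alg R) (T S : A -> A).
Local Notation "a ^†" := (cs_star A a) (at level 2, format "a ^†").
Hypothesis TST : forall a, T (S (T a)) = T a.
Hypothesis T_mul : forall a b, in_range S a \/ in_range S b -> T (a * b) = T a * T b.
Hypothesis ST : forall a, S (T a) = S 1 * a * S 1.

(** Put [f = T 1]. Then [T (S 1) = f^2]; multiplicativity at [S 1] gives [f^3 = f^2], and
    [f^4 = T (S 1 * S 1) = T (S (T 1)) = f]. Together these force [f^2 = f]. *)
Lemma unit_idem : (forall a, T (S a) = T 1 * a * T 1) -> T 1 * T 1 = T 1.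
Proof.
move=> TS; have rS : in_range S (S 1) by exists 1.
have e2 : S (T 1) = S 1 * S 1 by rewrite ST mulr1.
have f2 : T (S 1) = T 1 * T 1 by rewrite TS mulr1.
have f3 : T 1 * (T 1 * T 1) = T 1 * T 1.
  by rewrite -f2 -T_mul ?mul1r //; right.
have f4 : T 1 * T 1 * (T 1 * T 1) = T 1.
  by rewrite -{1 2}f2 -T_mul -?e2 ?TST //; left.
by rewrite -[RHS]f4 -mulrA f3 f3.
Qed.

(* Applying [S] to [T (a b) = T a T b] gives [e a (1 - e) b e = 0] for [e = S 1];
   now take [b = a^†]. *)
Lemma unit_central_of_hom : (forall a b, T (a * b) = T a * T b) ->
  (forall a b, in_range T a \/ in_range T b -> S (a * b) = S a * S b) ->
  S 1 * S 1 = S 1 -> (S 1)^† = S 1 -> in_center (S 1 : A).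
Proof.
move=> TM S_mul ee se; set e := S 1 in ee se *.
have key a b : e * (a * b) * e = e * a * e * b * e.
  rewrite -ST TM S_mul; last by left; exists a.
  by rewrite !ST -/e !mulrA -[_ * e * e]mulrA ee.
have half a : a * e = e * a * e.
  pose c := a * e - e * a * e; suff : c = 0 by move/eqP; rewrite subr_eq0 => /eqP.
  apply: star_mul_eq0.
  have ec : e * c = 0 by rewrite mulrBr !mulrA ee subrr.
  have -> : c^† = e * a^† - e * a^† * e by rewrite starB !starM se mulrA.
  rewrite mulrBl -[X in _ - X]mulrA ec mulr0 subr0 mulrBr !mulrA.
  by rewrite -[e * a^† * a]mulrA key subrr.
move=> a; have := congr1 (cs_star A) (half a^†).
by rewrite !starM se starK mulrA -half.
Qed.

End InteractionPair.

(** * Positive and negative parts in an ordered group *)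

Section OrderedGroup.
Variables (G : zmodType) (le : rel G).
Hypothesis og : tot_ordered_group le.
Implicit Types g x y : G.

Definition gpos g := if le 0 g then g else 0.
Definition gneg g := if le 0 g then 0 else - g.

Lemma le00 : le 0 0. Proof. by case: og. Qed.

Lemma le_add x y : le 0 x -> le 0 y -> le 0 (x + y).
Proof.
case: og => _ _ tr _ mon hx hy; apply: (tr _ _ _ hy).
by have := mon _ _ y hx; rewrite add0r.
Qed.

Lemma gpos_ge0 g : le 0 (gpos g).
Proof. by rewrite /gpos; case: ifP => // _; apply: le00. Qed.

Lemma gneg_ge0 g : le 0 (gneg g).
Proof.
rewrite /gneg; case: ifP => [_|ng]; first exact: le00.
case: og => _ _ _ tot mon; have [h|h] := tot 0 g; first by rewrite h in ng.
by have := mon _ _ (- g) h; rewrite subrr add0r.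
Qed.

Lemma gpos_id g : le 0 g -> gpos g = g. Proof. by rewrite /gpos => ->. Qed.

Lemma gposBneg g : gpos g = g + gneg g.
Proof. by rewrite /gpos /gneg; case: ifP; rewrite ?addr0 ?subrr. Qed.

Lemma gpos_step g y : le 0 y ->
  le 0 (gpos (g + y) - gpos g) /\ (gpos (g + y) = gpos g \/ gneg (g + y) = 0).
Proof.
move=> hy; rewrite /gpos /gneg; case: (boolP (le 0 g)) => hg.
  by rewrite (le_add hg hy) addrAC subrr add0r; split => //; right.
by rewrite subr0; case: ifP => h; split => //; [right|exact: le00|left].
Qed.

(** With [k] the increment of the positive part, this is the index identity behind
    [V_k V_n = V_n' V_y]. *)
Lemma gneg_step g y : gneg g + (gpos (g + y) - gpos g) = gneg (g + y) + y.
Proof.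
apply/eqP; rewrite !gposBneg addrA subr_eq [gneg g + _]addrC.
by rewrite [gneg (g + y) + y]addrC [X in _ == X]addrCA !addrA.
Qed.

End OrderedGroup.

Section CompleteInteraction.
Variables (R : realType) (G : zmodType) (le : rel G) (A : cstar_alg R).
Variables V H : G -> A -> A.
Hypothesis ci : is_complete_interaction le V H.
Implicit Types (x y : G) (a b c : A).

(** The axioms are symmetric, so each fact about [V] can also be read for [H]. *)
Lemma complete_interaction_sym : is_complete_interaction le H V.
Proof.
case: ci => [[aV aH int] HV VH comm]; split=> //.
  by split=> // x /int[].
by move=> x y hx hy; rewrite comm.
Qed.

Lemma V_bpl x : le 0 x -> bpl_map (V x).
Proof. by case: ci => [[[h _ _] _ _] _ _ _]; apply: h. Qed.

Lemma V_zero a : V 0 a = a.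
Proof. by case: ci => [[[_ -> _] _ _] _ _ _]. Qed.

Lemma V_add x y a : le 0 x -> le 0 y -> V x (V y a) = V (x + y) a.
Proof. by case: ci => [[[_ _ h] _ _] _ _ _] hx hy; rewrite -(h x y hx hy). Qed.

Lemma V_reg x a : le 0 x -> V x (H x (V x a)) = V x a.
Proof.
by case: ci => [[_ _ h] _ _ _] /h[e _ _ _]; rewrite -[in RHS]e.
Qed.

Lemma V_mul_range x a b : le 0 x -> in_range (H x) a \/ in_range (H x) b ->
  V x (a * b) = V x a * V x b.
Proof. by case: ci => [[_ _ h] _ _ _] /h[_ _ e _]; apply: e. Qed.

Lemma H_V x a : le 0 x -> H x (V x a) = H x 1 * a * H x 1.
Proof. by case: ci => [_ h _ _]; apply: h. Qed.

End CompleteInteraction.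

(** * The module over the group and its covariant pair *)

Section Representation.
Variables (R : realType) (G : zmodType) (le : rel G) (A : cstar_alg R).
Variables V H : G -> A -> A.
Local Notation "a ^†" := (cs_star A a) (at level 2, format "a ^†").
Local Notation nrm := (cs_nrm A).
Hypothesis og : tot_ordered_group le.
Hypothesis ci : is_complete_interaction le V H.
Hypothesis ce : forall x, le 0 x -> in_center (H x 1).
Implicit Types (g x y k : G) (a b c : A).

Let ci' := complete_interaction_sym ci.
Local Notation f x := (V x 1).
Local Notation e x := (H x 1).
Local Notation p := (gpos le).
Local Notation n := (gneg le).

Lemma V_H x a : le 0 x -> V x (H x a) = f x * a * f x.
Proof. exact: (H_V ci'). Qed.

Lemma f_idem x : le 0 x -> f x * f x = f x.
Proof.
move=> hx; apply: (@unit_idem _ _ (V x) (H x)) => [a|a b|a|a].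
- exact: (V_reg ci _ hx).
- exact: (V_mul_range ci hx).
- exact: (H_V ci _ hx).
- exact: V_H.
Qed.

Lemma e_idem x : le 0 x -> e x * e x = e x.
Proof.
move=> hx; apply: (@unit_idem _ _ (H x) (V x)) => [a|a b|a|a].
- exact: (V_reg ci' _ hx).
- exact: (V_mul_range ci' hx).
- exact: V_H.
- exact: (H_V ci _ hx).
Qed.

Lemma V_star x a : le 0 x -> V x a^† = (V x a)^†.
Proof. by move=> hx; apply/bpl_star/(V_bpl ci). Qed.

Lemma H_star x a : le 0 x -> H x a^† = (H x a)^†.
Proof. by move=> hx; apply/bpl_star/(V_bpl ci'). Qed.

Lemma f_sa x : le 0 x -> (f x)^† = f x.
Proof. by move=> hx; rewrite -V_star // star1. Qed.

Lemma e_sa x : le 0 x -> (e x)^† = e x.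
Proof. by move=> hx; rewrite -H_star // star1. Qed.

Lemma HV_e x a : le 0 x -> H x (V x a) = e x * a.
Proof. by move=> hx; rewrite (H_V ci) // -mulrA -(ce hx a) mulrA e_idem. Qed.

(** Centrality gives [H (V a) = e a], hence [V (a b) = V (e a b) = V (H (V a) b)], whose first
    factor lies in the range of [H x]. *)
Lemma V_mul x a b : le 0 x -> V x (a * b) = V x a * V x b.
Proof.
move=> hx; rewrite -(V_reg ci (a * b) hx) HV_e // mulrA -(HV_e a hx).
rewrite (V_mul_range ci hx); last by left; exists (V x a).
by rewrite (V_reg ci).
Qed.

Lemma e_H x a : le 0 x -> e x * H x a = H x a.
Proof. by move=> hx; rewrite -HV_e // (V_reg ci'). Qed.

Lemma H_e x a : le 0 x -> H x a * e x = H x a.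
Proof. by move=> hx; rewrite -(ce hx) e_H. Qed.

(** [H x] is a transfer operator for the endomorphism [V x]. *)
Lemma H_mulV x a c : le 0 x -> H x (a * V x c) = H x a * c.
Proof.
move=> hx; rewrite (V_mul_range ci') //; last by right; exists c.
by rewrite HV_e // mulrA H_e.
Qed.

Lemma H_Vmul x a c : le 0 x -> H x (V x c * a) = c * H x a.
Proof.
move=> hx; rewrite (V_mul_range ci') //; last by left; exists c.
by rewrite HV_e // (ce hx) -mulrA e_H.
Qed.

Lemma V_f x a : le 0 x -> V x a * f x = V x a.
Proof. by move=> hx; rewrite -V_mul // mulr1. Qed.

Lemma f_V x a : le 0 x -> f x * V x a = V x a.
Proof. by move=> hx; rewrite -V_mul // mul1r. Qed.

Lemma f_add_l x y : le 0 x -> le 0 y -> f (x + y) * f x = f (x + y).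
Proof. by move=> hx hy; rewrite -(V_add ci) // V_f. Qed.

Lemma f_add_r x y : le 0 x -> le 0 y -> f x * f (x + y) = f (x + y).
Proof. by move=> hx hy; rewrite -(V_add ci) // f_V. Qed.

Lemma V_le x a : le 0 x -> nonneg a -> nonneg (nrm a *r: 1 - V x a).
Proof.
move=> hx pa; apply: nonneg_sub_trans (bpl_le_unit (V_bpl ci hx) pa) _.
rewrite -scalerBr; apply: nonnegZ; first exact: norm_ge0.
by apply: nonneg_1subproj; rewrite ?f_sa ?f_idem.
Qed.

Lemma H_le x a : le 0 x -> nonneg a -> nonneg (nrm a *r: 1 - H x a).
Proof.
move=> hx pa; apply: nonneg_sub_trans (bpl_le_unit (V_bpl ci' hx) pa) _.
rewrite -scalerBr; apply: nonnegZ; first exact: norm_ge0.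
by apply: nonneg_1subproj; rewrite ?e_sa ?e_idem.
Qed.

Lemma V_contr x a : le 0 x -> nonneg a -> nrm (V x a) <= nrm a.
Proof.
move=> hx pa; apply: norm_le_rscalar (V_le hx pa); first exact: norm_ge0.
exact: (bpl_nonneg (V_bpl ci hx) pa).
Qed.

Lemma H_contr x a : le 0 x -> nonneg a -> nrm (H x a) <= nrm a.
Proof.
move=> hx pa; apply: norm_le_rscalar (H_le hx pa); first exact: norm_ge0.
exact: (bpl_nonneg (V_bpl ci' hx) pa).
Qed.

(* The site [g = p - n] stands for the elements [U_n^* a U_p]. *)
Definition site_in g a := f (n g) * a = a /\ a * f (p g) = a.
Definition site_ip g a b := H (p g) (a^† * b).
Definition site_mul g a c := a * V (p g) c.

Let p0 g : le 0 (p g) := gpos_ge0 og g.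
Let n0 g : le 0 (n g) := gneg_ge0 og g.

(** [H (p g)] does not increase the norm of [a^† a], and neither does [V (p g)], which brings it
    back because [a f (p g) = a]. *)
Lemma site_norm g a : site_in g a -> nrm (site_ip g a a) = nrm a ^+ 2.
Proof.
move=> [_ afp]; rewrite -norm_star_mul; apply/eqP; rewrite eq_le.
have pa := nonneg_star_mul a; rewrite H_contr //=.
have fa : f (p g) * a^† = a^† by rewrite -{2}afp starM f_sa.
have <- : V (p g) (site_ip g a a) = a^† * a.
  by rewrite V_H // mulrA fa -mulrA afp.
exact: V_contr (p0 g) (bpl_nonneg (V_bpl ci' (p0 g)) pa).
Qed.

Lemma site_fibres : is_fibres site_in site_ip site_mul.
Proof.
split.
- by move=> g; split; rewrite ?mulr0 ?mul0r.
- move=> g k a b [a1 a2] [b1 b2]; split.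
    by rewrite mulrDr -scalerAr a1 b1.
  by rewrite mulrDl -scalerAl a2 b2.
- move=> g u a hu ua; split.
    apply: cvg_uniq (cvg_mull _ ua) _; rewrite (_ : (fun m => _) = u) // funeqE.
    by move=> m; case: (hu m).
  apply: cvg_uniq (cvg_mulr _ ua) _; rewrite (_ : (fun m => _) = u) // funeqE.
  by move=> m; case: (hu m).
- move=> g a c [a1 a2]; split; first by rewrite mulrA a1.
  by rewrite -mulrA V_f.
- by move=> g a b c; rewrite /site_ip mulrDr (bplD (V_bpl ci' (p0 g))).
- by move=> g k a b; rewrite /site_ip -scalerAr (bplZ (V_bpl ci' (p0 g))).
- by move=> g a b; rewrite /site_ip -H_star // starM starK.
- by move=> g a b c; rewrite /site_ip mulrA H_mulV.
- by move=> g a; apply: (bpl_nonneg (V_bpl ci' (p0 g)) (nonneg_star_mul a)).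
- move=> g; case: (V_bpl ci' (p0 g)) => _ [M hM] _; exists `|M| => a b.
  apply: le_trans (hM _) _; apply: (@le_trans _ _ (`|M| * nrm (a^† * b))).
    by rewrite ler_wpM2r ?norm_ge0 ?ler_norm.
  by rewrite ler_wpM2l // -(norm_star a) normM.
- exact: site_norm.
- exists 0, 1; split; last by apply/eqP/oner_neq0.
  by split; rewrite ?mulr1 ?mul1r /gneg /gpos (le00 og) (V_zero ci).
Qed.

Definition site : fibres A G := Fibres site_fibres.

Lemma sigma_in a g b : site_in g b -> site_in g (V (n g) a * b).
Proof. by move=> [b1 b2]; split; rewrite ?mulrA ?f_V // -mulrA b2. Qed.

Lemma sigma_le a g b : site_in g b ->
  nonneg ((nrm a ^+ 2) *r: site_ip g b b - site_ip g (V (n g) a * b) (V (n g) a * b)).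
Proof.
move=> _; have bH := V_bpl ci' (p0 g).
have -> : (nrm a ^+ 2) *r: site_ip g b b - site_ip g (V (n g) a * b) (V (n g) a * b) =
   H (p g) (b^† * ((nrm a ^+ 2) *r: 1 - V (n g) (a^† * a)) * b).
  rewrite V_mul // V_star // mulrBr mulrBl bplB //; congr (_ - _).
    by rewrite -scalerAr mulr1 -scalerAl bplZ.
  by rewrite /site_ip starM !mulrA.
apply: (bpl_nonneg bH); apply: nonneg_conj; rewrite -norm_star_mul.
exact: V_le (nonneg_star_mul a).
Qed.

Lemma sigma_adj a g b c : site_in g b -> site_in g c ->
  site_ip g (V (n g) a * b) c = site_ip g b (V (n g) a^† * c).
Proof. by move=> _ _; rewrite /site_ip V_star // starM mulrA. Qed.

Definition sigma a : adjop_alg (l2_module site) :=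
  @shift_op R A G site id id (fun g => *%R (V (n g) a)) (fun g => *%R (V (n g) a^†))
    (nrm a ^+ 2) (nrm a^† ^+ 2) (fun _ => erefl) (fun _ => erefl)
    (sqr_ge0 _) (sigma_in a) (sigma_le a) (sigma_in a^†) (sigma_le a^†) (sigma_adj a).

(** * Moving a site by a positive group element *)

Section Step.
Variables (g y : G).
Hypothesis hy : le 0 y.
Let g' := g + y.
Let k := p g' - p g.
Let k0 : le 0 k := (gpos_step og g hy).1.
Let kp : p g' = k + p g. Proof. by rewrite subrK. Qed.
Let kn : n g + k = n g' + y. Proof. exact: gneg_step. Qed.

(** Either [y] merely shortens the negative part, or it uses it up and adds the remainder [k] to the
    positive part. *)
Lemma step_cases : (k = 0 /\ n g = n g' + y) \/ (n g' = 0 /\ y = n g + k).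
Proof.
case: (gpos_step og g hy) => _ [h|h]; [left|right].
  have k_0 : k = 0 by rewrite /k /g' h subrr.
  by split => //; rewrite -kn k_0 addr0.
by rewrite kn h add0r.
Qed.

Lemma f_ng'_ng : f (n g') * f (n g) = f (n g).
Proof.
case: step_cases => [[_ ->]|[-> _]]; first by rewrite f_add_r.
by rewrite (V_zero ci) mul1r.
Qed.

Lemma U_in a : site_in g a -> site_in g' (V k a).
Proof.
move=> [a1 a2]; split; last by rewrite kp -(V_add ci) // -V_mul // a2.
case: step_cases => [[-> _]|[-> _]]; last by rewrite (V_zero ci) mul1r.
by rewrite (V_zero ci) -{1}a1 mulrA f_ng'_ng.
Qed.

(** The factor [f (n g)] returns [H k b] to the corner of site [g]; it matters when the step crosses
    0. *)
Lemma U_adj_in b : site_in g' b -> site_in g (f (n g) * H k b).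
Proof.
move=> [b1 b2]; split; first by rewrite mulrA f_idem.
by rewrite -mulrA -H_mulV // (V_add ci) // -kp b2.
Qed.

Lemma H_p' b : H (p g') b = H (p g) (H k b).
Proof. by rewrite (V_add ci') // kp addrC. Qed.

(** [H_p' = H_p H_k], and the transfer property takes [V_k(a^†)] out of [H_k]; then [f_n a = a] lets
    the projection be inserted. *)
Lemma U_adj a b : site_in g a -> site_in g' b ->
  site_ip g' (V k a) b = site_ip g a (f (n g) * H k b).
Proof.
move=> [a1 _] _; rewrite /site_ip H_p' -V_star // H_Vmul // mulrA.
by rewrite -[in RHS](f_sa (n0 g)) -starM a1.
Qed.

Lemma U_le a : site_in g a ->
  nonneg (1 *r: site_ip g a a - site_ip g' (V k a) (V k a)).
Proof.
move=> _; rewrite rscale1 /site_ip H_p' -V_star // -V_mul // HV_e //.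
have bH := V_bpl ci' (p0 g); rewrite -bplB //; apply: (bpl_nonneg bH).
have -> : a^† * a - e k * (a^† * a) = a^† * (1 - e k) * a.
  by rewrite mulrBr mulr1 mulrBl -(ce k0) mulrA.
by apply/nonneg_conj/nonneg_1subproj; rewrite ?e_sa ?e_idem.
Qed.

(** Two projections are discarded: [f (n g)], and then [f k] in the Schwarz-type identity
    [H_k(b)^† H_k(b) = H_k(b^† f_k b)]. The latter rests on [b f_k = b], true because
    [p g' = k + p g]. *)
Lemma U_adj_le b : site_in g' b ->
  nonneg (1 *r: site_ip g' b b - site_ip g (f (n g) * H k b) (f (n g) * H k b)).
Proof.
move=> [_ b2]; rewrite rscale1 /site_ip H_p'.
have bH := V_bpl ci' (p0 g); have bHk := V_bpl ci' k0.
rewrite -bplB //; apply: (bpl_nonneg bH).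
apply: (@nonneg_sub_trans _ _ ((H k b)^† * H k b)).
  have -> : (H k b)^† * H k b - (f (n g) * H k b)^† * (f (n g) * H k b) =
      (H k b)^† * (1 - f (n g)) * H k b.
    rewrite starM f_sa // -mulrA [f _ * (f _ * _)]mulrA f_idem //.
    by rewrite mulrBr mulr1 mulrBl mulrA.
  by apply/nonneg_conj/nonneg_1subproj; rewrite ?f_sa ?f_idem.
have b3 : b * f k = b by rewrite -{1}b2 kp -mulrA f_add_l // -kp b2.
have Hb : H k b^† * H k b = H k (b^† * f k * b).
  have -> : b^† * f k * b = b^† * V k (H k b).
    by rewrite V_H // -mulrA -[f k * b * f k]mulrA b3.
  by rewrite H_mulV.
rewrite -H_star // Hb -bplB //; apply: (bpl_nonneg bHk).
have -> : b^† * b - b^† * f k * b = b^† * (1 - f k) * b.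
  by rewrite mulrBr mulr1 mulrBl.
by apply/nonneg_conj/nonneg_1subproj; rewrite ?f_sa ?f_idem.
Qed.

(** [V_k] undoes [H_k] up to [f_k], which [V_k] of the left factor and [b] absorb; what remains is
    [V_(k+n)(a) b] with [k + n = n' + y]. *)
Lemma U_covariant a b : site_in g' b ->
  V k (V (n g) a * (f (n g) * H k b)) = V (n g') (V y a) * b.
Proof.
move=> [_ b2]; have b3 : b * f k = b by rewrite -{1}b2 kp -mulrA f_add_l // -kp b2.
rewrite mulrA V_f // V_mul // V_H // -[f k * b * f k]mulrA b3 mulrA V_f //.
by rewrite !(V_add ci) // addrC kn.
Qed.

(** Completeness turns [V_n(H_y a)] into a compression by [f_n]: of [V_n'(a)] when [n = n' + y], and
    of [H_k(a)] when [y = n + k]. *)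
Lemma U_adj_covariant a b : site_in g b ->
  f (n g) * H k (V (n g') a * V k b) = V (n g) (H y a) * b.
Proof.
move=> [b1 _]; rewrite H_mulV //; case: step_cases => [[k_0 ng]|[ng' yk]].
  have -> : V (n g) (H y a) = f (n g) * V (n g') a * f (n g).
    by rewrite ng -(V_add ci) // V_H // !V_mul // !(V_add ci).
  by rewrite k_0 (V_zero ci') -!mulrA b1.
have -> : V (n g) (H y a) = f (n g) * H k a * f (n g).
  by rewrite yk -(V_add ci') // V_H.
by rewrite ng' (V_zero ci) -!mulrA b1.
Qed.

(** Centrality moves [e k] past [f (n g)], which [b] absorbs; the regularity [V H V = V] remains. *)
Lemma U_partial b : site_in g b -> V k (f (n g) * H k (V k b)) = V k b.
Proof.
move=> [b1 _]; rewrite HV_e // mulrA -(ce k0) -mulrA b1 -HV_e //.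
exact: (V_reg ci _ k0).
Qed.

End Step.

Section Shift.
Variable y : G.
Hypothesis hy : le 0 y.

Lemma shift_in j a : site_in (j - y) a -> site_in j (V (p j - p (j - y)) a).
Proof. by move=> h; have := U_in hy h; rewrite subrK. Qed.

Lemma shift_le j a : site_in (j - y) a ->
  nonneg (1 *r: site_ip (j - y) a a -
    site_ip j (V (p j - p (j - y)) a) (V (p j - p (j - y)) a)).
Proof. by move=> h; have := U_le hy h; rewrite subrK. Qed.

Lemma shift_ip j a b : site_in (j - y) a -> site_in j b ->
  site_ip j (V (p j - p (j - y)) a) b =
  site_ip (j - y) a (f (n (j - y)) * H (p (j - y + y) - p (j - y)) b).
Proof. by move=> ha hb; have := @U_adj _ _ hy a b ha; rewrite subrK; apply. Qed.

Definition shiftU : adjop_alg (l2_module site) :=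
  @shift_op R A G site (fun g => g + y) (fun g => g - y)
    (fun j => V (p j - p (j - y))) (fun g b => f (n g) * H (p (g + y) - p g) b)
    1 1 (addrK y) (subrK y) ler01
    shift_in shift_le (fun g => @U_adj_in g y hy) (fun g => @U_adj_le g y hy) shift_ip.

End Shift.

(* The positive part makes [U] total; it is the identity on [Gamma^+]. *)
Definition U x : adjop_alg (l2_module site) := shiftU (p0 x).

Lemma U_E x (xi : l2 site) j : le 0 x ->
  (U x : adjop _) xi j = V (p j - p (j - x)) (xi (j - x)).
Proof. by move=> hx /=; rewrite (gpos_id hx). Qed.

Lemma U_starE x (xi : l2 site) g : le 0 x ->
  (cs_star _ (U x) : adjop _) xi g = f (n g) * H (p (g + x) - p g) (xi (g + x)).
Proof. by move=> hx /=; rewrite (gpos_id hx). Qed.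

Lemma sigmaE a (xi : l2 site) g : (sigma a : adjop _) xi g = V (n g) a * xi g.
Proof. by []. Qed.

Lemma site_ext (S T : adjop_alg (l2_module site)) :
  (forall (xi : l2 site) g, (S : adjop _) xi g = (T : adjop _) xi g) -> S = T.
Proof. by move=> h; apply: adjop_eq => xi; apply: l2_eq => g; apply: h. Qed.

Lemma sigma_star_hom : star_hom sigma.
Proof.
split=> [k a b|a b|a].
- apply: site_ext => xi g; rewrite sigmaE.
  rewrite -[RHS]/(k *: (V (n g) a * xi g) + V (n g) b * xi g); have bV := V_bpl ci (n0 g).
  by rewrite bplD // bplZ // mulrDl scalerAl.
- by apply: site_ext => xi g; rewrite adjM !sigmaE V_mul // mulrA.
- exact: site_ext.
Qed.

Lemma sigma_one : sigma 1 = 1.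
Proof. by apply: site_ext => xi g; rewrite sigmaE; case: (l2_in xi g). Qed.

(** Evaluation at the vector 1 of degree 0, where [V_0 = id], recovers [a]. *)
Lemma sigma_inj : injective sigma.
Proof.
move=> a b ab; have n_0 : n 0 = 0 by rewrite /gneg (le00 og).
have D1 : fb_in site 0 1.
  by split; rewrite ?mulr1 ?mul1r /gpos ?n_0 ?(le00 og) (V_zero ci).
have := congr1 (fun T : adjop (l2_module site) => (T (l2_delta D1) : l2 site) 0) ab.
by rewrite !sigmaE l2_deltaE n_0 !(V_zero ci) !mulr1.
Qed.

(** The increments of the positive part along [j - x - y], [j - x], [j] are nonnegative and
    telescope. *)
Lemma U_add x y : le 0 x -> le 0 y -> U (x + y) = U x * U y.
Proof.
move=> hx hy; apply: site_ext => xi j.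
have := (gpos_step og (j - x) hx).1; have := (gpos_step og (j - x - y) hy).1.
rewrite !subrK => h1 h2; have hxy := le_add og hx hy.
by rewrite adjM !U_E // (V_add ci) // subrKA opprD addrA.
Qed.

Lemma U_partial_isometry x : le 0 x -> partial_isometry (U x).
Proof.
move=> hx; apply: site_ext => xi j.
have := @U_partial (j - x) x hx _ (l2_in xi (j - x)); rewrite subrK => h.
by rewrite !adjM U_E // U_starE // !U_E // subrK.
Qed.

Lemma sigma_V x a : le 0 x -> sigma (V x a) = U x * sigma a * cs_star _ (U x).
Proof.
move=> hx; apply: site_ext => xi j.
have := @U_covariant (j - x) x hx a (xi j); rewrite subrK => h.
by rewrite !adjM U_E // !sigmaE U_starE // subrK h //; apply: (l2_in xi j).
Qed.

Lemma sigma_H x a : le 0 x -> sigma (H x a) = cs_star _ (U x) * sigma a * U x.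
Proof.
move=> hx; apply: site_ext => xi g; rewrite !adjM U_starE // !sigmaE U_E // addrK.
by rewrite (U_adj_covariant hx) //; apply: (l2_in xi g).
Qed.

Lemma central_finely_representable :
  finely_representable le V /\ finely_representable le H.
Proof.
have sigma_ok : [/\ star_hom sigma, sigma 1 = 1 & injective sigma].
  by split; [exact: sigma_star_hom|exact: sigma_one|exact: sigma_inj].
split.
  exists (adjop_alg (l2_module site)), sigma, U; split=> // [x y|x|x a].
  - exact: U_add.
  - exact: U_partial_isometry.
  - by move=> hx; split; [exact: sigma_V|exists (H x a); rewrite sigma_H].
exists (adjop_alg (l2_module site)), sigma, (fun x => cs_star _ (U x)).
split=> // [x y hx hy|x hx|x a hx].
(* The star reverses products; commutativity of the group restores the order. *)
- by rewrite addrC U_add // starM.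
- by have := congr1 (cs_star _) (U_partial_isometry hx); rewrite !starM mulrA.
- by rewrite starK; split; [exact: sigma_H|exists (V x a); rewrite sigma_V].
Qed.

End Representation.

(** * Reduction of the four hypotheses to a central unit *)

Lemma hom_unit_central (R : realType) (G : zmodType) (le : rel G)
    (A : cstar_alg R) (V H : G -> A -> A) (x : G) :
  is_complete_interaction le V H -> le 0 x -> star_hom (V x) -> in_center (H x 1).
Proof.
move=> ci hx [_ VM _]; have ci' := complete_interaction_sym ci.
apply: (@unit_central_of_hom _ _ (V x) (H x)) => [a|//|a b||].
- exact: (H_V ci).
- exact: (V_mul_range ci').
- apply: (@unit_idem _ _ (H x) (V x)) => [a|a b|a|a].
  + exact: (V_reg ci').
  + exact: (V_mul_range ci').
  + exact: (H_V ci').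
  + exact: (H_V ci).
- by rewrite -(bpl_star (V_bpl ci' hx)) star1.
Qed.

Theorem theorem4p3 (R : realType) (G : zmodType) (le : rel G)
    (A : cstar_alg R) (V H : G -> A -> A) :
  tot_ordered_group le ->
  is_complete_interaction le V H ->
  ((forall x, le 0 x -> star_hom (V x)) \/
   (forall x, le 0 x -> in_center (H x 1)) \/
   (forall x, le 0 x -> star_hom (H x)) \/
   (forall x, le 0 x -> in_center (V x 1))) ->
  finely_representable le V /\ finely_representable le H.
Proof.
move=> og ci hyp; have ci' := complete_interaction_sym ci.
case: hyp => [hV|[eC|[hH|fC]]].
- apply: (central_finely_representable og ci) => x hx.
  exact: (hom_unit_central ci hx (hV x hx)).
- exact: (central_finely_representable og ci eC).
- apply/and_comm/(central_finely_representable og ci') => x hx.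
  exact: (hom_unit_central ci' hx (hH x hx)).
- exact/and_comm/(central_finely_representable og ci' fC).
Qed.
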